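(* Let $k$ be a field and let $V=k[t,t^{-1}]$. The double bracket $$\{\!\{f,g\}\!\}_0(x,y)=\frac{f(x)g(y)-g(x)f(y)}{y-x},\qquad f,g\in V,$$ is a double Lie bracket of weight $0$, i.e. $(V,\{\!\{\cdot,\cdot\}\!\}_0)$ is a double Lie algebra. Moreover, the double Lie algebra $(V,\{\!\{\cdot,\cdot\}\!\}_0)$ is simple.
   Context: $k$ is a field, $V=k[t,t^{-1}]$ is the space of Laurent polynomials, and $V\otimes V$ (tensor product over $k$) is identified with $k[x^{\pm1},y^{\pm1}]$ by $t^a\otimes t^b\leftrightarrow x^ay^b$ (so $x=t\otimes 1$, $y=1\otimes t$). Since $y-x$ divides $f(x)g(y)-g(x)f(y)$ in $k[x^{\pm1},y^{\pm1}]$, the quotient is understood as an element of $k[x^{\pm1},y^{\pm1}]=V\otimes V$. For a vector space $W$ over $k$, $u\in W^{\otimes n}$ and a permutation $\sigma$ of the tensor factors, $u^\sigma$ denotes the result of applying $\sigma$ to $u$ (e.g. $(a\otimes b\otimes c)^{(12)}=b\otimes a\otimes c$). Let $\lambda\in k$. A $\lambda$-double Lie algebra (a space with a double Lie bracket of weight $\lambda$) is a vector space $W$ over $k$ with a bilinear map $\{\!\{\cdot,\cdot\}\!\}\colon W\times W\to W\otimes W$ such that for all $a,b,c\in W$ $$\{\!\{a,b\}\!\}+\{\!\{b,a\}\!\}^{(12)}=\lambda(a\otimes b-b\otimes a),$$ $$\{\!\{a,\{\!\{b,c\}\!\}\}\!\}_L-\{\!\{b,\{\!\{a,c\}\!\}\}\!\}_R-\{\!\{\{\!\{a,b\}\!\},c\}\!\}_L=-\lambda\,(b\otimes\{\!\{a,c\}\!\})^{(12)},$$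 where the actions on tensor products are determined (linearly) by $$\{\!\{a,u\otimes v\}\!\}_L=\{\!\{a,u\}\!\}\otimes v,\quad \{\!\{a,u\otimes v\}\!\}_R=u\otimes\{\!\{a,v\}\!\},\quad \{\!\{u\otimes v,a\}\!\}_L=(\{\!\{u,a\}\!\}\otimes v)^{(23)}.$$ For $\lambda=0$ this is called a double Lie algebra. A subspace $I\subseteq W$ is an ideal if $\{\!\{W,I\}\!\}+\{\!\{I,W\}\!\}\subseteq I\otimes W+W\otimes I$. A $\lambda$-double Lie algebra is simple if its double product is nonzero and its only ideals are $0$ and $W$. *)

(* Defs.v *)
From HB Require Import structures.
From mathcomp Require Import all_boot all_order all_algebra.
From mathcomp Require Import finmap boolp.
From mathcomp Require Import monalg.

Set Implicit Arguments.
Unset Strict Implicit.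
Unset Printing Implicit Defensive.

Import Order.TTheory GRing.Theory Num.Theory.

Local Open Scope ring_scope.
Local Open Scope quotient_scope.

Local Notation bilinear f := (bilinear_for *:%R *:%R f).

(* The tensor product of two modules over a commutative ring: the free module *)
(* {malg k[U * V]} modulo the submodule generated by the bilinearity relators. *)

Section TensorDef.
Variables (k : comNzRingType) (U V : lmodType k).

Definition tens_relators (S : {pred {malg k[(U * V)%type]}}) : Prop :=
  (forall (a : k) (u u' : U) (v : V),
     << (a *: u + u', v) >> - (a *: << (u, v) >> + << (u', v) >>) \in S) /\
  (forall (a : k) (u : U) (v v' : V),
     << (u, a *: v + v') >> - (a *: << (u, v) >> + << (u, v') >>) \in S).

Definition tens_null (w : {malg k[(U * V)%type]}) : Prop :=
  forall S : {pred {malg k[(U * V)%type]}},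
    submod_closed S -> tens_relators S -> w \in S.

Definition tens_eqv (w w' : {malg k[(U * V)%type]}) : bool :=
  `[< tens_null (w - w') >].

Lemma tens_null0 : tens_null 0.
Proof. by move=> S [S0 _] _. Qed.

Lemma tens_nullP (a : k) w w' :
  tens_null w -> tens_null w' -> tens_null (a *: w + w').
Proof.
by move=> nw nw' S cS rS; case: (cS) => _; apply; [apply: nw | apply: nw'].
Qed.

Lemma tens_nullD w w' : tens_null w -> tens_null w' -> tens_null (w + w').
Proof. by move=> nw nw'; rewrite -[w]scale1r; apply: tens_nullP. Qed.

Lemma tens_nullZ a w : tens_null w -> tens_null (a *: w).
Proof. by move=> nw; rewrite -[a *: w]addr0; exact: tens_nullP tens_null0. Qed.

Lemma tens_nullN w : tens_null w -> tens_null (- w).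
Proof. by move=> nw; rewrite -scaleN1r; apply: tens_nullZ. Qed.

Lemma tens_eqv_refl : reflexive tens_eqv.
Proof. by move=> w; rewrite /tens_eqv subrr; apply/asboolP/tens_null0. Qed.

Lemma tens_eqv_sym : symmetric tens_eqv.
Proof.
by move=> w w'; apply: asbool_equiv_eq; split=> /tens_nullN; rewrite opprB.
Qed.

Lemma tens_eqv_trans : transitive tens_eqv.
Proof.
move=> w' w w'' /asboolP n1 /asboolP n2; apply/asboolP.
by rewrite -(subrKA w'); apply: tens_nullD.
Qed.

Canonical tens_equiv := EquivRel tens_eqv tens_eqv_refl tens_eqv_sym tens_eqv_trans.
Canonical tens_encModRel := defaultEncModRel tens_eqv.

Definition tensor := {eq_quot tens_eqv}.
HB.instance Definition _ := Choice.on tensor.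
HB.instance Definition _ := EqQuotient.on tensor.

Lemma tens_eqP (w w' : {malg k[(U * V)%type]}) :
  \pi_tensor w = \pi_tensor w' <-> tens_null (w - w').
Proof. by rewrite (rwP eqP) eqmodE; split=> /asboolP. Qed.

Definition tens_zero : tensor := lift_cst tensor 0.
Definition tens_add := lift_op2 tensor +%R.
Definition tens_opp := lift_op1 tensor -%R.
Definition tens_scale (a : k) := lift_op1 tensor ( *:%R a).

Canonical pi_tens_zero := PiConst tens_zero.

Lemma pi_add : {morph \pi : w w' / w + w' >-> tens_add w w'}.
Proof.
move=> w w'; unlock tens_add; apply/tens_eqP.
rewrite opprD addrACA; apply: tens_nullD; apply/tens_eqP; by rewrite reprK.
Qed.
Canonical pi_tens_add := PiMorph2 pi_add.

Lemma pi_opp : {morph \pi : w / - w >-> tens_opp w}.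
Proof.
move=> w; unlock tens_opp; apply/tens_eqP.
by rewrite -opprD; apply/tens_nullN/tens_eqP; rewrite reprK.
Qed.
Canonical pi_tens_opp := PiMorph1 pi_opp.

Lemma pi_scale a : {morph \pi : w / a *: w >-> tens_scale a w}.
Proof.
move=> w; unlock tens_scale; apply/tens_eqP.
by rewrite -scalerBr; apply/tens_nullZ/tens_eqP; rewrite reprK.
Qed.
Canonical pi_tens_scale a := PiMorph1 (pi_scale a).

Lemma tens_addA : associative tens_add.
Proof. by do 3!elim/quotW=> ?; rewrite !piE addrA. Qed.
Lemma tens_addC : commutative tens_add.
Proof. by do 2!elim/quotW=> ?; rewrite !piE addrC. Qed.
Lemma tens_add0 : left_id tens_zero tens_add.
Proof. by elim/quotW=> ?; rewrite !piE add0r. Qed.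
Lemma tens_addN : left_inverse tens_zero tens_opp tens_add.
Proof. by elim/quotW=> ?; rewrite !piE addNr. Qed.

HB.instance Definition _ :=
  GRing.isZmodule.Build tensor tens_addA tens_addC tens_add0 tens_addN.

Lemma tens_scaleA a b w : tens_scale a (tens_scale b w) = tens_scale (a * b) w.
Proof. by elim/quotW: w => w; rewrite !piE scalerA. Qed.
Lemma tens_scale1 : left_id 1 tens_scale.
Proof. by elim/quotW=> w; rewrite !piE scale1r. Qed.
Lemma tens_scaleDr : right_distributive tens_scale +%R.
Proof.
move=> a; do 2!elim/quotW=> ?.
by rewrite /GRing.add /= !piE scalerDr.
Qed.
Lemma tens_scaleDl w : {morph tens_scale^~ w : a b / a + b}.
Proof.
by elim/quotW: w => w a b; rewrite [RHS]/GRing.add /= !piE scalerDl.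
Qed.

HB.instance Definition _ := GRing.Zmodule_isLmodule.Build k tensor
  tens_scaleA tens_scale1 tens_scaleDr tens_scaleDl.

Definition tens (u : U) (v : V) : tensor := \pi_tensor << (u, v) >>.

Lemma pi_tens_linear : linear (\pi_tensor : {malg k[(U * V)%type]} -> tensor).
Proof. by move=> a w w'; rewrite pi_add pi_scale. Qed.

Lemma tens_bilinear : bilinear tens.
Proof.
split=> [v a u u'|u a v v']; rewrite /= /tens -pi_tens_linear; apply/tens_eqP.
  by move=> S _ [r _]; apply: r.
by move=> S _ [_ r]; apply: r.
Qed.

End TensorDef.

Notation "U ⊗ V" := (tensor U%type V%type) (at level 40, left associativity) : type_scope.
Notation "u ⊗ v" := (tens u v) (at level 40, left associativity) : ring_scope.

(* The linear map U ⊗ V -> P with u ⊗ v |-> b u v; meaningful when b is        *)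
(* bilinear, see tlift_tens and tlift_linear.                                 *)

Section TensorLift.
Variables (k : comNzRingType) (U V P : lmodType k) (b : U -> V -> P).

Definition free_lift (w : {malg k[(U * V)%type]}) : P :=
  \sum_(p <- msupp w) w@_p *: b p.1 p.2.

Definition tlift (w : U ⊗ V) : P := free_lift (repr w).

Lemma free_liftEw (d : {fset U * V}) w : (msupp w `<=` d)%fset ->
  free_lift w = \sum_(p <- d) w@_p *: b p.1 p.2.
Proof.
move=> le; rewrite /free_lift (big_fset_incl _ le) //= => p _ /mcoeff_outdom ->.
by rewrite scale0r.
Qed.

Lemma free_liftU u v : free_lift << (u, v) >> = b u v.
Proof. by rewrite (free_liftEw msuppU_le) big_seq_fset1 mcoeffUU scale1r. Qed.

Lemma free_lift_linear : linear free_lift.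
Proof.
move=> a w w'; pose d := (msupp w `|` msupp w')%fset.
rewrite (@free_liftEw d w) ?fsubsetUl // (@free_liftEw d w') ?fsubsetUr //.
rewrite (@free_liftEw d); last first.
  exact: fsubset_trans (msuppD_le _ _) (fsetSU _ (msuppZ_le _ _)).
rewrite scaler_sumr -big_split; apply: eq_bigr => p _ /=.
by rewrite mcoeffD mcoeffZ scalerDl scalerA.
Qed.

Hypothesis bP : bilinear b.

Lemma free_lift_null w : tens_null w -> free_lift w = 0.
Proof.
have l0 : free_lift 0 = 0.
  by have := free_lift_linear (-1) 0 0; rewrite scaler0 addr0 scaleN1r addNr.
have lB w1 w2 : free_lift (w1 - w2) = free_lift w1 - free_lift w2.
  by have := free_lift_linear (-1) w2 w1; rewrite !scaleN1r ![- _ + _]addrC.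
move=> /(_ [pred w | free_lift w == 0]) nw; apply/eqP/nw.
  split=> [|a w1 w2]; rewrite !inE ?l0 // => /eqP w10 /eqP w20.
  by rewrite free_lift_linear w10 w20 scaler0 addr0.
split=> [a u u' v|a u v v']; rewrite inE lB free_lift_linear !free_liftU.
  by rewrite (bP.1 v) subrr.
by rewrite (bP.2 u) subrr.
Qed.

Lemma tlift_pi w : tlift (\pi w) = free_lift w.
Proof.
apply/eqP; rewrite -subr_eq0 /tlift -[- _]scaleN1r addrC -free_lift_linear.
apply/eqP/free_lift_null; rewrite scaleN1r addrC.
by apply/tens_eqP; rewrite reprK.
Qed.

Lemma tlift_tens u v : tlift (u ⊗ v) = b u v.
Proof. by rewrite tlift_pi free_liftU. Qed.

Lemma tlift_linear : linear tlift.
Proof.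
move=> a; do 2!elim/quotW=> ?.
by rewrite -pi_tens_linear !tlift_pi free_lift_linear.
Qed.

End TensorLift.

Section DoubleLie.
Variables (k : fieldType) (W : lmodType k).

(* The threefold tensor power of W is taken to be (W ⊗ W) ⊗ W. *)
Definition tassoc : W ⊗ (W ⊗ W) -> W ⊗ W ⊗ W :=
  tlift (fun a => tlift (fun b c => a ⊗ b ⊗ c)).

Definition swap : W ⊗ W -> W ⊗ W := tlift (fun a b => b ⊗ a).
Definition perm12 : W ⊗ W ⊗ W -> W ⊗ W ⊗ W := tlift (fun w c => swap w ⊗ c).
Definition perm23 : W ⊗ W ⊗ W -> W ⊗ W ⊗ W :=
  tlift (fun w c => tlift (fun a b => a ⊗ c ⊗ b) w).

Variable br : W -> W -> W ⊗ W.

(* {{a, w}}_L, {{a, w}}_R and {{w, a}}_L for w in W ⊗ W. *)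
Definition actL (a : W) : W ⊗ W -> W ⊗ W ⊗ W :=
  tlift (fun u v => br a u ⊗ v).
Definition actR (a : W) : W ⊗ W -> W ⊗ W ⊗ W :=
  tlift (fun u v => tassoc (u ⊗ br a v)).
Definition ractL (w : W ⊗ W) (a : W) : W ⊗ W ⊗ W :=
  tlift (fun u v => perm23 (br u a ⊗ v)) w.

Definition double_Lie (lambda : k) : Prop :=
  [/\ bilinear br,
      forall a b, br a b + swap (br b a) = lambda *: (a ⊗ b - b ⊗ a)
    & forall a b c,
        actL a (br b c) - actR b (br a c) - ractL (br a b) c
          = - lambda *: perm12 (tassoc (b ⊗ br a c))].

(* The subspace A ⊗ B of W ⊗ W, for subspaces A and B of W. *)
Definition tens_sub (A B : {pred W}) (w : W ⊗ W) : Prop :=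
  exists2 s : seq (W * W),
    (forall p, p \in s -> (p.1 \in A) && (p.2 \in B))
    & w = \sum_(p <- s) p.1 ⊗ p.2.

(* The subspace I ⊗ W + W ⊗ I of W ⊗ W. *)
Definition tens_ideal (I : {pred W}) (w : W ⊗ W) : Prop :=
  exists w1 w2, [/\ tens_sub I predT w1, tens_sub predT I w2 & w = w1 + w2].

(* Since I ⊗ W + W ⊗ I is a subspace, the inclusion of {{W, I}} + {{I, W}} is  *)
(* stated on generators. Boolean predicates are no restriction here: by     *)
(* boolp, every P : W -> Prop is reflected by the predicate `[< P w >].       *)
Definition ideal (I : {pred W}) : Prop :=
  submod_closed I /\
  forall w i, i \in I -> tens_ideal I (br w i) /\ tens_ideal I (br i w).

Definition simple_double_Lie : Prop :=
  (exists a b, br a b != 0) /\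
  forall I : {pred W}, ideal I -> (I =i pred1 0) \/ (I =i predT).

End DoubleLie.

(* The group algebra k[G] of an additive abelian group G. The ring structure  *)
(* that monalg puts on {malg k[M]} is not available for G, as it requires the *)
(* monoid M to have no invertible element besides the neutral one.            *)

Definition grpalg (k : comNzRingType) (G : zmodType) : Type := {malg k[G]}.

(* The operations are locked for efficiency only. *)
HB.lock Definition ga_zero (k : comNzRingType) (G : zmodType) : grpalg k G :=
  (0 : {malg k[G]}).
HB.lock Definition ga_opp (k : comNzRingType) (G : zmodType) (f : grpalg k G) :
    grpalg k G := (- (f : {malg k[G]}) : {malg k[G]}).
HB.lock Definition ga_add (k : comNzRingType) (G : zmodType)
    (f g : grpalg k G) : grpalg k G :=
  ((f : {malg k[G]}) + (g : {malg k[G]}) : {malg k[G]}).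
HB.lock Definition ga_scale (k : comNzRingType) (G : zmodType) (c : k)
    (f : grpalg k G) : grpalg k G := (c *: (f : {malg k[G]}) : {malg k[G]}).
HB.lock Definition monom (k : comNzRingType) (G : zmodType) (a : G) :
    grpalg k G := << a >>.
HB.lock Definition ga_coef (k : comNzRingType) (G : zmodType) (f : grpalg k G)
    (a : G) : k := (f : {malg k[G]})@_a.
HB.lock Definition ga_supp (k : comNzRingType) (G : zmodType) (f : grpalg k G) :
    {fset G} := msupp (f : {malg k[G]}).

Section GroupAlgebraLmod.
Variables (k : comNzRingType) (G : zmodType).

HB.instance Definition _ := Choice.on (grpalg k G).

Fact ga_addA : associative (@ga_add k G).
Proof. by move=> f g h; rewrite ga_add.unlock addrA. Qed.
Fact ga_addC : commutative (@ga_add k G).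
Proof. by move=> f g; rewrite ga_add.unlock addrC. Qed.
Fact ga_add0 : left_id (@ga_zero k G) (@ga_add k G).
Proof. by move=> f; rewrite ga_add.unlock ga_zero.unlock add0r. Qed.
Fact ga_addN : left_inverse (@ga_zero k G) (@ga_opp k G) (@ga_add k G).
Proof.
by move=> f; rewrite ga_add.unlock ga_opp.unlock ga_zero.unlock addNr.
Qed.

HB.instance Definition _ :=
  GRing.isZmodule.Build (grpalg k G) ga_addA ga_addC ga_add0 ga_addN.

Fact ga_scaleA (c d : k) (f : grpalg k G) :
  ga_scale c (ga_scale d f) = ga_scale (c * d) f.
Proof. by rewrite ga_scale.unlock scalerA. Qed.
Fact ga_scale1 : left_id 1 (@ga_scale k G).
Proof. by move=> f; rewrite ga_scale.unlock scale1r. Qed.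
Fact ga_scaleDr : right_distributive (@ga_scale k G) +%R.
Proof.
move=> c f g; rewrite -[f + g]/(ga_add f g) -[RHS]/(ga_add _ _).
by rewrite ga_add.unlock ga_scale.unlock scalerDr.
Qed.
Fact ga_scaleDl (f : grpalg k G) : {morph (@ga_scale k G)^~ f : c d / c + d}.
Proof.
move=> c d; rewrite -[RHS]/(ga_add _ _).
by rewrite ga_add.unlock ga_scale.unlock scalerDl.
Qed.

HB.instance Definition _ := GRing.Zmodule_isLmodule.Build k (grpalg k G)
  ga_scaleA ga_scale1 ga_scaleDr ga_scaleDl.

Implicit Types f g : grpalg k G.

Lemma ga_coefP f g : (forall a, ga_coef f a = ga_coef g a) -> f = g.
Proof. by move=> e; apply/malgP => a; have := e a; rewrite ga_coef.unlock. Qed.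

Lemma ga_coef0 a : ga_coef (0 : grpalg k G) a = 0.
Proof.
by rewrite -[0 : grpalg k G]/(@ga_zero k G) ga_coef.unlock ga_zero.unlock mcoeff0.
Qed.

Lemma ga_coefD f g a : ga_coef (f + g) a = ga_coef f a + ga_coef g a.
Proof.
by rewrite -[f + g]/(ga_add f g) ga_coef.unlock ga_add.unlock mcoeffD.
Qed.

Lemma ga_coefZ c f a : ga_coef (c *: f) a = c * ga_coef f a.
Proof.
by rewrite -[c *: f]/(ga_scale c f) ga_coef.unlock ga_scale.unlock mcoeffZ.
Qed.

Lemma ga_coefU (a b : G) : ga_coef (monom k a) b = (a == b)%:R.
Proof. by rewrite ga_coef.unlock monom.unlock mcoeffU. Qed.

Lemma ga_coef_out f a : a \notin ga_supp f -> ga_coef f a = 0.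
Proof. by rewrite ga_coef.unlock ga_supp.unlock; apply: mcoeff_outdom. Qed.

Lemma ga_suppE f a : (a \in ga_supp f) = (ga_coef f a != 0).
Proof. by rewrite ga_coef.unlock ga_supp.unlock mcoeff_neq0. Qed.

Lemma ga_supp_sub f (d : {fset G}) :
  (forall a, ga_coef f a != 0 -> a \in d) -> (ga_supp f `<=` d)%fset.
Proof. by move=> h; apply/fsubsetP => a; rewrite ga_suppE; apply: h. Qed.

Lemma ga_suppU (a : G) : (ga_supp (monom k a) `<=` [fset a])%fset.
Proof.
apply: ga_supp_sub => b; rewrite ga_coefU inE [b == a]eq_sym.
by case: (a == b); rewrite // eqxx.
Qed.

Lemma ga_supp_lin c f g :
  (ga_supp (c *: f + g)%R `<=` ga_supp f `|` ga_supp g)%fset.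
Proof.
apply: ga_supp_sub => a; rewrite in_fsetU !ga_suppE ga_coefD ga_coefZ.
by have [->|//] := eqVneq (ga_coef f a) 0; rewrite mulr0 add0r.
Qed.

(* The linear map k[G] -> M with monom a |-> F a. *)
Definition ga_lin (M : lmodType k) (F : G -> M) f : M :=
  \sum_(a <- ga_supp f) ga_coef f a *: F a.

Lemma ga_linEw M F f (d : {fset G}) : (ga_supp f `<=` d)%fset ->
  @ga_lin M F f = \sum_(a <- d) ga_coef f a *: F a.
Proof.
move=> le; rewrite /ga_lin (big_fset_incl _ le) //= => a _ /ga_coef_out ->.
by rewrite scale0r.
Qed.

Lemma ga_lin_linear M F : linear (@ga_lin M F).
Proof.
move=> c f g; have le := ga_supp_lin c f g.
rewrite (ga_linEw _ le) (ga_linEw F (fsubsetUl (ga_supp f) (ga_supp g))).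
rewrite (ga_linEw F (fsubsetUr (ga_supp f) (ga_supp g))).
rewrite scaler_sumr -big_split; apply: eq_bigr => a _ /=.
by rewrite ga_coefD ga_coefZ scalerDl scalerA.
Qed.

Lemma ga_lin_monom M F (a : G) : @ga_lin M F (monom k a) = F a.
Proof.
by rewrite (ga_linEw _ (ga_suppU a)) big_seq_fset1 ga_coefU eqxx scale1r.
Qed.

Lemma monomE f : f = \sum_(a <- ga_supp f) ga_coef f a *: monom k a.
Proof.
apply: ga_coefP => b.
rewrite (big_morph (fun h : grpalg k G => ga_coef h b)
  (fun g h => ga_coefD g h b) (ga_coef0 b)).
have [bf|bf] := boolP (b \in ga_supp f).
  rewrite (big_fsetD1 b) //= ga_coefZ ga_coefU eqxx mulr1.
  rewrite big1_fset ?addr0 // => a; rewrite in_fsetD1 ga_coefZ ga_coefU.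
  by case: eqP => // _ _ _; rewrite mulr0.
rewrite (ga_coef_out bf) big1_fset // => a af _; rewrite ga_coefZ ga_coefU.
by case: eqP af bf => [-> ->//|_ _ _]; rewrite mulr0.
Qed.

Lemma monom_ind (P : grpalg k G -> Prop) :
  P 0 -> (forall c f g, P f -> P g -> P (c *: f + g)) ->
  (forall a, P (monom k a)) -> forall f, P f.
Proof.
move=> P0 PD PU f; rewrite (monomE f); elim/big_rec: _ => // a g _ Pg.
exact: PD.
Qed.

End GroupAlgebraLmod.

HB.lock Definition ga_mul (k : comNzRingType) (G : zmodType) (f g : grpalg k G) :
    grpalg k G :=
  \sum_(a <- ga_supp f) \sum_(b <- ga_supp g)
     (ga_coef f a * ga_coef g b) *: monom k (a + b).

Section GroupAlgebra.
Variables (k : comNzRingType) (G : zmodType).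

Local Notation monom := (@monom k G).
Local Notation ga_mul := (@ga_mul k G).
Implicit Types f g h : grpalg k G.

Lemma ga_mulE f g :
  ga_mul f g = ga_lin (fun a => ga_lin (fun b => monom (a + b)) g) f.
Proof.
rewrite ga_mul.unlock; apply: eq_bigr => a _; rewrite scaler_sumr.
by apply: eq_bigr => b _; rewrite scalerA.
Qed.

Lemma ga_mulC : commutative ga_mul.
Proof.
move=> f g; rewrite ga_mul.unlock exchange_big; apply: eq_bigr => a _ /=.
by apply: eq_bigr => b _; rewrite mulrC addrC.
Qed.

Lemma ga_mul_linear f : linear (ga_mul f).
Proof. by move=> c g h; rewrite ![ga_mul f _]ga_mulC !ga_mulE ga_lin_linear. Qed.

Lemma ga_mulr0 f : ga_mul f 0 = 0.
Proof.
by have := ga_mul_linear f (-1) 0 0; rewrite scaler0 addr0 scaleN1r addNr.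
Qed.

Lemma ga_mulUU a b : ga_mul (monom a) (monom b) = monom (a + b).
Proof. by rewrite ga_mulE !ga_lin_monom. Qed.

Lemma ga_mulA : associative ga_mul.
Proof.
move=> f g h; elim/monom_ind: h => [|c h h' IH IH'|r].
- by rewrite !ga_mulr0.
- by rewrite !ga_mul_linear IH IH'.
rewrite -[RHS]ga_mulC; elim/monom_ind: g => [|c g g' IH IH'|b].
- by rewrite [ga_mul 0 _]ga_mulC !ga_mulr0.
- rewrite [ga_mul (_ + _) _]ga_mulC !ga_mul_linear.
  by rewrite ![ga_mul (monom r) _]ga_mulC IH IH' ![ga_mul _ (monom r)]ga_mulC.
rewrite ga_mulUU; elim/monom_ind: f => [|c f f' IH IH'|a].
- by rewrite ![ga_mul 0 _]ga_mulC !ga_mulr0.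
- rewrite [LHS]ga_mulC ga_mul_linear ![ga_mul (monom (b + r)) _]ga_mulC IH IH'.
  rewrite [in RHS](ga_mulC _ (monom b)) ga_mul_linear.
  by rewrite ![ga_mul (monom b) _]ga_mulC ga_mul_linear.
by rewrite !ga_mulUU addrA addrC.
Qed.

Lemma ga_mul1 : left_id (monom 0) ga_mul.
Proof.
move=> f; elim/monom_ind: f => [|c f g IH IH'|a].
- by rewrite ga_mulr0.
- by rewrite ga_mul_linear IH IH'.
by rewrite ga_mulUU add0r.
Qed.

Lemma ga_mulDl : left_distributive ga_mul +%R.
Proof.
move=> f g h; rewrite ga_mulC -[f in LHS]scale1r ga_mul_linear scale1r.
by rewrite ![ga_mul h _]ga_mulC.
Qed.

Lemma ga_1_neq0 : monom 0 != 0.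
Proof.
apply/eqP => /(congr1 (fun f : grpalg k G => ga_coef f 0)).
by rewrite ga_coefU eqxx ga_coef0; apply/eqP/oner_neq0.
Qed.

HB.instance Definition _ := GRing.Zmodule_isComNzRing.Build (grpalg k G)
  ga_mulA ga_mulC ga_mul1 ga_mulDl ga_1_neq0.

Lemma ga_scaleAl (c : k) f g : c *: (f * g) = (c *: f) * g.
Proof.
rewrite [RHS]mulrC -[c *: f]addr0 [RHS]ga_mul_linear ga_mulr0 addr0.
by rewrite ga_mulC.
Qed.

HB.instance Definition _ := GRing.Lmodule_isLalgebra.Build k (grpalg k G)
  ga_scaleAl.
HB.instance Definition _ := GRing.Lalgebra_isComAlgebra.Build k (grpalg k G).

End GroupAlgebra.

Section Laurent.
Variable k : comNzRingType.

Definition laurent : comAlgType k := grpalg k int.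
Definition laurent2 : comAlgType k := grpalg k (int * int)%type.

(* t^a and x^a y^b *)
Definition tpow (a : int) : laurent := monom k a.
Definition xypow (a b : int) : laurent2 := monom k (a, b).

Lemma laurent_ind (P : laurent -> Prop) :
  P 0 -> (forall c f g, P f -> P g -> P (c *: f + g)) ->
  (forall a, P (tpow a)) -> forall f, P f.
Proof. exact: monom_ind. Qed.

Lemma xypowD a b c d : xypow (a + c) (b + d) = xypow a b * xypow c d.
Proof. by rewrite [RHS]ga_mulUU. Qed.

Lemma xypow0 : xypow 0 0 = 1. Proof. by []. Qed.

(* The linear map k[t^(+-1)] -> M with t^a |-> F a, and the linear map         *)
(* k[x^(+-1), y^(+-1)] -> M with x^a y^b |-> F a b.                           *)
Definition laurent_lin (M : lmodType k) (F : int -> M) (f : laurent) : M :=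
  ga_lin F f.

Definition laurent2_lin (M : lmodType k) (F : int -> int -> M) (p : laurent2) : M :=
  ga_lin (fun m => F m.1 m.2) p.

Lemma laurent_lin_linear M F : linear (@laurent_lin M F).
Proof. exact: ga_lin_linear. Qed.

Lemma laurent2_lin_linear M F : linear (@laurent2_lin M F).
Proof. exact: (ga_lin_linear (fun m => F m.1 m.2)). Qed.

Lemma laurent_linE M F a : @laurent_lin M F (tpow a) = F a.
Proof. exact: ga_lin_monom. Qed.

Lemma laurent2_linE M F a b : @laurent2_lin M F (xypow a b) = F a b.
Proof. exact: (ga_lin_monom (fun m => F m.1 m.2)). Qed.

End Laurent.

Section Bracket.
Variable k : fieldType.

Local Notation V := (laurent k).

Definition varx : laurent2 k := xypow k 1 0.
Definition vary : laurent2 k := xypow k 0 1.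

Definition in_x : V -> laurent2 k := laurent_lin (fun a => xypow k a 0).
Definition in_y : V -> laurent2 k := laurent_lin (fun b => xypow k 0 b).

(* x^a y^b |-> t^a ⊗ t^b *)
Definition laurent2_tens : laurent2 k -> V ⊗ V :=
  laurent2_lin (fun a b => tpow k a ⊗ tpow k b).

Lemma in_x_linear : linear in_x. Proof. exact: laurent_lin_linear. Qed.
Lemma in_y_linear : linear in_y. Proof. exact: laurent_lin_linear. Qed.

Lemma varxX n : varx ^+ n = xypow k n%:Z 0.
Proof.
elim: n => [|n IH]; first by rewrite expr0 xypow0.
by rewrite exprSr IH -xypowD -addn1 PoszD addr0.
Qed.

Lemma varyX n : vary ^+ n = xypow k 0 n%:Z.
Proof.
elim: n => [|n IH]; first by rewrite expr0 xypow0.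
by rewrite exprSr IH -xypowD -addn1 PoszD addr0.
Qed.

Lemma bracket_num_monom (a b : int) : exists q : laurent2 k,
  (vary - varx) * q = xypow k a b - xypow k b a.
Proof.
have H c d : (c <= d)%R -> exists q : laurent2 k,
    (vary - varx) * q = xypow k c d - xypow k d c.
  move=> le_cd; have [n ->] : exists n : nat, d = c + n%:Z.
    by exists `|d - c|%N; rewrite gez0_abs ?subr_ge0 // subrKC.
  exists (xypow k c c * \sum_(i < n) vary ^+ (n.-1 - i) * varx ^+ i).
  by rewrite mulrCA -subrXX mulrBr varyX varxX -!xypowD !addr0.
have [le_ab|/ltW le_ba] := lerP a b; first exact: H.
by have [q qE] := H b a le_ba; exists (- q); rewrite mulrN qE opprB.
Qed.

Lemma bracket_num_dvd (f g : V) : exists q : laurent2 k,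
  (vary - varx) * q == in_x f * in_y g - in_x g * in_y f.
Proof.
suff [q qE] : exists q : laurent2 k,
    (vary - varx) * q = in_x f * in_y g - in_x g * in_y f by exists q; apply/eqP.
have z0 (F : V -> laurent2 k) : linear F -> F 0 = 0.
  by move=> /(_ (-1) 0 0); rewrite scaler0 addr0 scaleN1r addNr.
have [x0 y0] := (z0 _ in_x_linear, z0 _ in_y_linear).
elim/laurent_ind: f => [|c f f' [q qE] [q' q'E]|a].
- by exists 0; rewrite x0 y0 !(mulr0, mul0r) subrr.
- exists (c *: q + q'); rewrite in_x_linear in_y_linear mulrDr -scalerAr qE q'E.
  by rewrite mulrDl mulrDr -scalerAl -scalerAr scalerBr opprD addrACA.
elim/laurent_ind: g => [|c g g' [q qE] [q' q'E]|b].
- by exists 0; rewrite x0 y0 !(mulr0, mul0r) subrr.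
- exists (c *: q + q'); rewrite in_x_linear in_y_linear mulrDr -scalerAr qE q'E.
  by rewrite mulrDl mulrDr -scalerAl -scalerAr scalerBr opprD addrACA.
have [q qE] := bracket_num_monom a b; exists q.
by rewrite /in_x /in_y !laurent_linE -!xypowD !addr0 !add0r.
Qed.

(* The quotient (f(x) g(y) - g(x) f(y)) / (y - x); it is unique because        *)
(* k[x^(+-1), y^(+-1)] is a domain.                                           *)
Definition bracket0_quot (f g : V) : laurent2 k := xchoose (bracket_num_dvd f g).

Lemma bracket0_quotE (f g : V) :
  (vary - varx) * bracket0_quot f g = in_x f * in_y g - in_x g * in_y f.
Proof. exact/eqP/(xchooseP (bracket_num_dvd f g)). Qed.

Definition bracket0 (f g : V) : V ⊗ V := laurent2_tens (bracket0_quot f g).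

End Bracket.

(* Main.v *)
Require Import Defs.
From mathcomp Require Import all_boot all_order all_algebra finmap.
From mathcomp Require Import boolp classical_sets monalg ring zify.
Import Order.TTheory GRing.Theory Num.Theory.
Local Open Scope quotient_scope.
Local Open Scope ring_scope.

Set Implicit Arguments.
Unset Strict Implicit.
Unset Printing Implicit Defensive.

(* Jacobi identity: after embedding V ⊗ V ⊗ V into k[x^±1, y^±1, z^±1], each of *)
(* its three terms is determined by its product with y - x, z - y or z - x,   *)
(* because differences of two distinct monomials are regular; the product of  *)
(* the whole expression with all three differences is identically zero.       *)
(*                                                                            *)
(* Simplicity: let I be an ideal with 0 <> I <> V, and phi a nonzero linear   *)
(* functional vanishing on I. Then (id ⊗ phi) maps I ⊗ V + V ⊗ I to I, so     *)
(* h_m(f) = (id ⊗ phi) {{f, t^m}} is in I for f in I. From the quotient,      *)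
(* h_(m+1)(f) = t h_m(f) + phi(t^m) f. Let f in I be nonzero with exponents   *)
(* in a shortest possible interval, starting at n. The exponents of h_n(f)    *)
(* lie in a shorter one, so h_n(f) = 0, and its top coefficient gives         *)
(* phi(t^n) = 0. Running the recurrence up and down from m = n to the nearest *)
(* m with phi(t^m) <> 0 shows that t f, respectively f / t, is in I, and it   *)
(* is again minimal; shifting until the interval starts at that m is absurd.  *)

(** Everything follows from the relation (y - x) q = f(x) g(y) - g(x) f(y), which determines the
    quotient q because y - x is regular ([monomB_lreg], [quotP]). It yields bilinearity, the
    symmetry of q in x and y and hence antisymmetry ([quot_sym]), and closed formulas for the three
    Jacobi terms after clearing one difference each ([tens3_actL], [tens3_actR], [tens3_ractL]).
    [jacobi_cleared] combines these, and [tens3K] carries the result back to tensors.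

    For simplicity it is enough that a functional [phi] vanishing on an ideal with a nonzero element
    is zero ([ideal_phi0]): a vector outside the ideal would be separated from it by
    [submod_functional]. Contracting the second factor by [phi] turns brackets with t^m into slices,
    which stay in the ideal ([contract_ideal]), obey a one-step recurrence in m ([slice_shift]) and
    shorten supports ([slice_supp]). An element of least width starting at n forces phi(t^n) = 0
    ([minimal_phi]); [minimal_phi_up] and [minimal_phi_down] extend this to all exponents. *)

Section LinearProp.
Variables (k : pzRingType) (U V : lmodType k) (f : U -> V).
Hypothesis fL : linear f.

Lemma lin0 : f 0 = 0.
Proof. by have := fL (-1) 0 0; rewrite scaler0 addr0 scaleN1r addNr. Qed.

Lemma linD u v : f (u + v) = f u + f v.
Proof. by rewrite -[u in LHS]scale1r fL scale1r. Qed.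

Lemma linZ a u : f (a *: u) = a *: f u.
Proof. by rewrite -[a *: u]addr0 fL lin0 addr0. Qed.

Lemma linN u : f (- u) = - f u.
Proof. by rewrite -scaleN1r linZ scaleN1r. Qed.

Lemma linB u v : f (u - v) = f u - f v.
Proof. by rewrite linD linN. Qed.

Lemma lin_sum (I : Type) (r : seq I) (F : I -> U) :
  f (\sum_(i <- r) F i) = \sum_(i <- r) f (F i).
Proof. exact: (big_morph f linD lin0). Qed.

Lemma lin_comp (W : lmodType k) (g : V -> W) : linear g -> linear (g \o f).
Proof. by move=> gL a u v; rewrite /= fL gL. Qed.

End LinearProp.

Lemma lin_mull (k : comNzRingType) (U : lmodType k) (A : comAlgType k) (p : A)
  (f : U -> A) : linear f -> linear (fun u => p * f u).
Proof. by move=> fL a u v; rewrite fL mulrDr scalerAr. Qed.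

Lemma lin_mulr (k : comNzRingType) (U : lmodType k) (A : comAlgType k) (p : A)
  (f : U -> A) : linear f -> linear (fun u => f u * p).
Proof. by move=> fL a u v; rewrite fL mulrDl scalerAl. Qed.

Lemma lin_sub (k : comNzRingType) (U V : lmodType k) (f g : U -> V) :
  linear f -> linear g -> linear (fun u => f u - g u).
Proof. by move=> fL gL a u v; rewrite fL gL scalerBr opprD addrACA. Qed.

Lemma lin_comb (k : comNzRingType) (U V : lmodType k) (c : k) (f g : U -> V) :
  linear f -> linear g -> linear (fun u => c *: f u + g u).
Proof.
move=> fL gL a u v; rewrite fL gL !scalerDr !scalerA [c * a]mulrC -!scalerA.
exact: addrACA.
Qed.

Section Extensionality.
Variables (k : comNzRingType).

Lemma ga_ext (G : zmodType) (M : lmodType k) (F F' : grpalg k G -> M) :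
  linear F -> linear F' -> (forall a, F (monom k a) = F' (monom k a)) ->
  F =1 F'.
Proof.
move=> FL FL' e; elim/monom_ind => [|c f g Hf Hg|//].
  by rewrite (lin0 FL) (lin0 FL').
by rewrite FL FL' Hf Hg.
Qed.

Lemma tens_ext (U V M : lmodType k) (F F' : U ⊗ V -> M) :
  linear F -> linear F' -> (forall u v, F (u ⊗ v) = F' (u ⊗ v)) -> F =1 F'.
Proof.
move=> FL FL' e; elim/quotW => w; rewrite [w]monalgE.
have piL := @pi_tens_linear k U V.
have FpL := lin_comp piL FL; have FpL' := lin_comp piL FL'.
rewrite -[LHS]/((F \o \pi_(tensor U V)) _) (lin_sum FpL).
rewrite -[RHS]/((F' \o \pi_(tensor U V)) _) (lin_sum FpL').
apply: eq_bigr => -[u v] _.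
have -> : << w@_(u, v) *g (u, v) >> = w@_(u, v) *: << (u, v) >>.
  by apply/malgP => p; rewrite mcoeffZ !mcoeffU mulr_natr.
by rewrite (linZ FpL) (linZ FpL') /= e.
Qed.

End Extensionality.

(** * Group algebras: induced homomorphisms and regular elements *)

Lemma monomM (k : comNzRingType) (G : zmodType) (a b : G) :
  monom k a * monom k b = monom k (a + b).
Proof. exact: ga_mulUU. Qed.

Section GroupAlgebraMap.
Variables (k : comNzRingType) (G H : zmodType) (s : G -> H).

Definition ga_map : grpalg k G -> grpalg k H := ga_lin (fun a => monom k (s a)).

Lemma ga_map_linear : linear ga_map.
Proof. exact: ga_lin_linear. Qed.

Lemma ga_mapU a : ga_map (monom k a) = monom k (s a).
Proof. exact: ga_lin_monom. Qed.

End GroupAlgebraMap.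

Lemma ga_mapM (k : comNzRingType) (G H : zmodType) (s : G -> H) :
  {morph s : a b / a + b} -> {morph ga_map (k := k) s : f g / f * g}.
Proof.
move=> sD f g.
have mL := @ga_map_linear k G H s.
move: f; apply: ga_ext => [||a]; last move: g; last apply: ga_ext => [||b].
- exact: (lin_comp (lin_mulr g (fun _ _ _ => erefl)) mL).
- exact: lin_mulr.
- exact: (lin_comp (lin_mull _ (fun _ _ _ => erefl)) mL).
- exact: lin_mull.
by rewrite /= !ga_mapU monomM ga_mapU sD monomM.
Qed.

Section Regular.
Variables (k : comNzRingType) (G : zmodType).

Lemma ga_coef_monomM (a b : G) (q : grpalg k G) :
  ga_coef (monom k a * q) b = ga_coef q (b - a).
Proof.
move: q; elim/monom_ind => [|c f g Hf Hg|d].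
- by rewrite mulr0 !ga_coef0.
- by rewrite mulrDr -scalerAr !ga_coefD !ga_coefZ Hf Hg.
by rewrite monomM !ga_coefU [d == _]eq_sym subr_eq [d + a]addrC [b == _]eq_sym.
Qed.

(** The relation makes the coefficients of [q] invariant under translation by [d - c]. This element
    has infinite order, so one nonzero coefficient would produce infinitely many. *)
Lemma monomB_reg (c d : G) (q : grpalg k G) :
  (forall n, (d - c) *+ n = 0 -> n = 0%N) ->
  (monom k d - monom k c) * q = 0 -> q = 0.
Proof.
move=> tf q0; apply: ga_coefP => a; rewrite ga_coef0.
have step b : ga_coef q (b + (d - c)) = ga_coef q b.
  have := congr1 (fun p : grpalg k G => ga_coef p (b + d)) q0.
  rewrite mulrBl -scaleN1r ga_coefD ga_coefZ !ga_coef_monomM ga_coef0 mulN1r.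
  by rewrite addrK addrA => /eqP; rewrite subr_eq0 => /eqP.
have stepn n : ga_coef q (a + (d - c) *+ n) = ga_coef q a.
  by elim: n => [|n IH]; rewrite ?addr0 // mulrSr addrA step.
apply/eqP/negPn/negP => qa.
(* One more translate of [a] than the support has elements. *)
pose s := [seq a + (d - c) *+ n | n <- iota 0 (size (ga_supp q)).+1].
have us : uniq s.
  rewrite map_inj_uniq ?iota_uniq // => m n /addrI.
  wlog le_mn : m n / (m <= n)%N.
    by move=> W; have [le|/ltnW le] := leqP m n; [|move=> /esym]; move=> /W -> .
  move/esym/eqP; rewrite -subr_eq0 -mulrnBr // => /eqP/tf/eqP.
  by rewrite subn_eq0 => le_nm; apply/eqP; rewrite eqn_leq le_mn.
have /(uniq_leq_size us) : {subset s <= ga_supp q}.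
  by move=> _ /mapP[n _ ->]; rewrite ga_suppE stepn.
by rewrite size_map size_iota ltnn.
Qed.

Lemma monomB_lreg (c d : G) :
  (forall n, (d - c) *+ n = 0 -> n = 0%N) ->
  GRing.lreg (monom k d - monom k c).
Proof.
move=> tf p q /= e; apply/eqP; rewrite -subr_eq0; apply/eqP.
by apply: (monomB_reg tf); rewrite mulrBr e subrr.
Qed.

End Regular.


(* A subspace maximal among those containing I and avoiding v is a complement  *)
(* of the line spanned by v, and phi is the projection along it.               *)
Lemma submod_functional (k : fieldType) (W : lmodType k) (I : {pred W}) (v : W) :
  submod_closed I -> v \notin I ->
  exists phi : W -> k^o, [/\ linear phi, phi v = 1 & {in I, phi =1 fun=> 0}].
Proof.
move=> Isub vI.
(* Adjoining [I] makes the empty chain harmless in Zorn's lemma: its union is the empty set, and [U]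
   of it is [I]. *)
pose U (A : set W) := [set u | u \in I \/ A u]%classic.
pose sub (A : set W) := A 0 /\ forall a u w, A u -> A w -> A (a *: u + w).
have [F FP|A [[[A0 AP] vA] Amax]] :=
  @Zorn_bigcup W (fun A => sub (U A) /\ ~ U A v).
  move=> Ftot; split; last first.
    case=> [|[X FX Xv]]; first exact/negP.
    by case: (FP _ FX) => _; apply; right.
  split=> [|a u w]; first by left; case: Isub.
  case=> [uI|[X FX Xu]] [wI|[Y FY Yw]].
  - by left; case: Isub => _; apply.
  - have [[_ /(_ a u w)] h _] := FP _ FY.
    by case: h => [||?|?]; [left|right|left|right; exists Y].
  - have [[_ /(_ a u w)] h _] := FP _ FX.
    by case: h => [||?|?]; [right|left|left|right; exists X].
  have [XY|YX] := Ftot _ _ FX FY.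
    have [[_ /(_ a u w)] h _] := FP _ FY.
    by case: h => [||?|?]; [right; apply: XY|right|left|right; exists Y].
  have [[_ /(_ a u w)] h _] := FP _ FX.
  by case: h => [||?|?]; [right|right; apply: YX|left|right; exists X].
have dec u : exists c, U A (u - c *: v).
  have [Au|nAu] := pselect (U A u); first by exists 0; rewrite scale0r subr0.
  (* [B] is the span of [U A] and [u]. By maximality it contains [v], and the coefficient of [u] in
     [v] is nonzero, so [u] lies in [U A] plus the line of [v]. *)
  pose B := [set w | exists c, U A (w - c *: u)]%classic.
  have UB w : U B w <-> B w.
    by split=> [[wI|//]|]; [exists 0; rewrite scale0r subr0; left|right].
  apply/not_existsP => nv; apply: (Amax B).
    split=> [w Aw|BA]; first by exists 0; rewrite scale0r subr0; right.
    by apply: nAu; right; apply: BA; exists 1; rewrite scale1r subrr.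
  split; last first.
    move=> /UB[c Ac]; have [c0|c0] := eqVneq c 0.
      by apply: vA; move: Ac; rewrite c0 scale0r subr0.
    apply: (nv c^-1); have := AP (- c^-1) _ _ Ac A0.
    by rewrite addr0 scalerBr !scaleNr opprK scalerA mulVf // scale1r addrC.
  split=> [|a w w' /UB[c Ac] /UB[c' Ac']]; apply/UB.
    by exists 0; rewrite scale0r subr0.
  exists (a * c + c'); have := AP a _ _ Ac Ac'.
  by rewrite scalerBr scalerA scalerDl opprD addrACA.
have [phi phiP] := choice dec.
have uniq u c : U A (u - c *: v) -> phi u = c.
  move=> Ac; apply/eqP; rewrite -subr_eq0; apply/negPn/negP => d0; apply: vA.
  have := AP (-1) _ _ (phiP u) Ac.
  have -> : -1 *: (u - phi u *: v) + (u - c *: v) = (phi u - c) *: v.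
    by rewrite scaleN1r opprB subrKA -scalerBl.
  move=> /(AP (phi u - c)^-1 _ 0)/(_ A0).
  by rewrite addr0 scalerA mulVf // scale1r.
exists phi; split=> [a u w||u uI].
- apply: uniq; have := AP a _ _ (phiP u) (phiP w).
  by rewrite scalerBr scalerA scalerDl opprD addrACA.
- by apply: uniq; rewrite scale1r subrr.
by apply: uniq; rewrite scale0r subr0; left.
Qed.

(** * Bilinearity of basic maps *)

Section Bilinear.
Variables (k : comNzRingType) (U V : lmodType k).

Lemma tens_linearl (v : V) : linear (fun u : U => u ⊗ v).
Proof. exact: (tens_bilinear U V).1. Qed.

Lemma tens_linearr (u : U) : linear (fun v : V => u ⊗ v).
Proof. exact: (tens_bilinear U V).2. Qed.

Lemma mul_bilinear (A : comAlgType k) (f : U -> A) (g : V -> A) :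
  linear f -> linear g -> bilinear_for *:%R *:%R (fun u v => f u * g v).
Proof.
by move=> fL gL; split=> [v|u]; [exact: lin_mulr | exact: lin_mull].
Qed.

End Bilinear.

Lemma swap_bilinear (k : comNzRingType) (U V : lmodType k) :
  bilinear_for *:%R *:%R (fun (u : U) (v : V) => v ⊗ u).
Proof. by split=> [v|u]; [exact: tens_linearr | exact: tens_linearl]. Qed.


Lemma cross_linear (k : comNzRingType) (A : comAlgType k) (a : k)
  (u u' v w p p' : A) :
  a *: (u * v - w * p) + (u' * v - w * p') = (a *: u + u') * v - w * (a *: p + p').
Proof.
by rewrite mulrDl mulrDr -scalerAl -scalerAr scalerBr opprD addrACA.
Qed.

(** * The quotient by y - x and antisymmetry of the bracket *)

Section Quotient.
Variable k : fieldType.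

Local Notation V := (laurent k).
Local Notation X := (varx k).
Local Notation Y := (vary k).
Local Notation quot := (@bracket0_quot k).

Lemma yBx_lreg : GRing.lreg (Y - X).
Proof.
apply: monomB_lreg => n /(congr1 snd) /=.
by rewrite raddfMn /= subr0 => /eqP; rewrite mulrn_eq0 orbF => /eqP.
Qed.

Lemma quotP (f g : V) q :
  (Y - X) * q = in_x f * in_y g - in_x g * in_y f -> quot f g = q.
Proof. by rewrite -bracket0_quotE => /yBx_lreg. Qed.

Lemma quot_linearl g : linear (fun f => quot f g).
Proof.
move=> a f f'; apply: quotP; rewrite in_x_linear in_y_linear -cross_linear.
move: (bracket0_quotE f g) (bracket0_quotE f' g).
by move: (quot f g) (quot f' g) => q q' <- <-; rewrite mulrDr -scalerAr.
Qed.

Lemma quotN f g : quot g f = - quot f g.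
Proof. by apply: quotP; rewrite mulrN bracket0_quotE opprB. Qed.

Lemma quot_linearr f : linear (quot f).
Proof. by move=> a g g'; rewrite !(quotN _ f) quot_linearl opprD scalerN. Qed.

Lemma laurent2_tens_linear : linear (@laurent2_tens k).
Proof. exact: laurent2_lin_linear. Qed.

Lemma laurent2_tensU a b : laurent2_tens (xypow k a b) = tpow k a ⊗ tpow k b.
Proof. exact: laurent2_linE. Qed.

Lemma bracket0_linearl g : linear (fun f => @bracket0 k f g).
Proof. exact/(lin_comp (quot_linearl g))/laurent2_tens_linear. Qed.

Lemma bracket0_linearr f : linear (@bracket0 k f).
Proof. exact/(lin_comp (quot_linearr f))/laurent2_tens_linear. Qed.

Lemma bracket0_bilinear : bilinear_for *:%R *:%R (@bracket0 k).
Proof. by split; [exact: bracket0_linearl | exact: bracket0_linearr]. Qed.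

Lemma swap_linear : linear (@swap k V).
Proof. exact/tlift_linear/swap_bilinear. Qed.

Definition swap_exp (p : int * int) : int * int := (p.2, p.1).

Lemma swap_laurent2_tens (q : laurent2 k) :
  swap (laurent2_tens q) = laurent2_tens (ga_map swap_exp q).
Proof.
move: q; apply: ga_ext => [||[a b]].
- exact/(lin_comp laurent2_tens_linear)/swap_linear.
- exact/(lin_comp (ga_map_linear _))/laurent2_tens_linear.
rewrite -[monom k _]/(xypow k a b) ga_mapU -[monom k _]/(xypow k b a).
by rewrite !laurent2_tensU /swap tlift_tens //; exact: swap_bilinear.
Qed.

Lemma swap_exp_x (f : V) : ga_map swap_exp (in_x f) = in_y f.
Proof.
move: f; apply: ga_ext => [||a].
- exact/(lin_comp (@in_x_linear k))/ga_map_linear.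
- exact: in_y_linear.
by rewrite /in_x /in_y !laurent_linE ga_mapU.
Qed.

Lemma swap_exp_y (f : V) : ga_map swap_exp (in_y f) = in_x f.
Proof.
move: f; apply: ga_ext => [||a].
- exact/(lin_comp (@in_y_linear k))/ga_map_linear.
- exact: in_x_linear.
by rewrite /in_x /in_y !laurent_linE ga_mapU.
Qed.

(** Exchanging x and y negates both the numerator and y - x. *)
Lemma quot_sym (f g : V) : ga_map swap_exp (quot f g) = quot f g.
Proof.
have sM : {morph swap_exp : a b / a + b} by [].
symmetry; apply: quotP; apply: oppr_inj.
have := congr1 (ga_map swap_exp) (bracket0_quotE f g).
rewrite (ga_mapM sM) !(linB (ga_map_linear _)) !(ga_mapM sM).
rewrite !swap_exp_x !swap_exp_y [in_y f * _]mulrC [in_y g * _]mulrC -[RHS]opprB => <-.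
by rewrite !ga_mapU -mulNr opprB.
Qed.

Lemma bracket0_antisym (f g : V) : bracket0 f g + swap (bracket0 g f) = 0.
Proof.
rewrite swap_laurent2_tens quot_sym quotN (linN laurent2_tens_linear).
exact: subrr.
Qed.

End Quotient.

(** * Structural maps on tensor powers and the three actions *)

Lemma bilin_pre (k : comNzRingType) (U U' V V' P : lmodType k)
    (b : U' -> V' -> P) (f : U -> U') (g : V -> V') :
  bilinear_for *:%R *:%R b -> linear f -> linear g ->
  bilinear_for *:%R *:%R (fun u v => b (f u) (g v)).
Proof.
by move=> [bl br] fL gL; split=> [v|u];
  [exact: (lin_comp fL (bl (g v))) | exact: (lin_comp gL (br (f u)))].
Qed.

Lemma bilin_post (k : comNzRingType) (U V P Q : lmodType k)
    (b : U -> V -> P) (h : P -> Q) :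
  bilinear_for *:%R *:%R b -> linear h ->
  bilinear_for *:%R *:%R (fun u v => h (b u v)).
Proof.
by move=> [bl br] hL; split=> [v|u];
  [exact: (lin_comp (bl v) hL) | exact: (lin_comp (br u) hL)].
Qed.

Lemma id_linear (k : comNzRingType) (U : lmodType k) : linear (id : U -> U).
Proof. by []. Qed.

Lemma bilin_flip (k : comNzRingType) (U V P : lmodType k) (b : U -> V -> P) :
  bilinear_for *:%R *:%R b -> bilinear_for *:%R *:%R (fun v u => b u v).
Proof. by case. Qed.

(** Serves [tassoc] and [perm23], where one lift is nested in another and the inner one depends
    linearly on the outer variable. *)
Lemma tlift_param_bilinear (k : comNzRingType) (A U V P : lmodType k)
    (b : A -> U -> V -> P) :
  (forall a, bilinear_for *:%R *:%R (b a)) ->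
  (forall u v, linear (fun a => b a u v)) ->
  bilinear_for *:%R *:%R (fun a => tlift (b a)).
Proof.
move=> bP bL; split=> [w|a]; last exact: tlift_linear.
move=> c a a'; move: w; apply: tens_ext => [||u v].
- exact: tlift_linear.
- by apply: lin_comb; exact: tlift_linear.
by rewrite !tlift_tens // bL.
Qed.

Section StructuralMaps.
Variables (k : fieldType) (W : lmodType k).

Lemma tassoc_in_bilinear (a : W) :
  bilinear_for *:%R *:%R (fun b c : W => a ⊗ b ⊗ c).
Proof.
apply: (bilin_pre (b := @tens k (W ⊗ W)%type W) (f := fun b => a ⊗ b) (g := id)).
- exact: tens_bilinear.
- exact: tens_linearr.
- exact: id_linear.
Qed.

Lemma tassoc_bilinear : bilinear_for *:%R *:%R
  (fun (a : W) => tlift (fun b c : W => a ⊗ b ⊗ c)).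
Proof.
apply: (tlift_param_bilinear (b := fun a b c => a ⊗ b ⊗ c)).
  exact: tassoc_in_bilinear.
move=> u v; exact: (lin_comp (tens_linearl u) (tens_linearl v)).
Qed.

Lemma tassoc_linear : linear (@tassoc k W).
Proof. exact/tlift_linear/tassoc_bilinear. Qed.

Lemma tassocE (a b c : W) : tassoc (a ⊗ (b ⊗ c)) = a ⊗ b ⊗ c.
Proof.
rewrite /tassoc (tlift_tens tassoc_bilinear).
exact: (tlift_tens (tassoc_in_bilinear a)).
Qed.

Lemma perm23_in_bilinear (c : W) :
  bilinear_for *:%R *:%R (fun a b : W => a ⊗ c ⊗ b).
Proof.
apply: (bilin_pre (b := @tens k (W ⊗ W)%type W) (f := fun a => a ⊗ c) (g := id)).
- exact: tens_bilinear.
- exact: tens_linearl.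
- exact: id_linear.
Qed.

Lemma perm23_bilinear : bilinear_for *:%R *:%R
  (fun (w : W ⊗ W) (c : W) => tlift (fun a b => a ⊗ c ⊗ b) w).
Proof.
apply/bilin_flip/(tlift_param_bilinear (b := fun c a b => a ⊗ c ⊗ b)).
  exact: perm23_in_bilinear.
move=> u v; exact: (lin_comp (tens_linearr u) (tens_linearl v)).
Qed.

Lemma perm23_linear : linear (@perm23 k W).
Proof. exact/tlift_linear/perm23_bilinear. Qed.

Lemma perm23E (a b c : W) : perm23 (a ⊗ b ⊗ c) = a ⊗ c ⊗ b.
Proof.
rewrite /perm23 (tlift_tens perm23_bilinear).
exact: (tlift_tens (perm23_in_bilinear c)).
Qed.

Variable br : W -> W -> W ⊗ W.
Hypothesis brP : bilinear_for *:%R *:%R br.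

Lemma actL_bilinear a : bilinear_for *:%R *:%R (fun u v : W => br a u ⊗ v).
Proof.
apply: (bilin_pre (b := @tens k (W ⊗ W)%type W) (f := br a) (g := id)).
- exact: tens_bilinear.
- exact: brP.2.
- exact: id_linear.
Qed.

Lemma actR_bilinear a :
  bilinear_for *:%R *:%R (fun u v : W => tassoc (u ⊗ br a v)).
Proof.
apply: (bilin_post (b := fun u v => u ⊗ br a v)); last exact: tassoc_linear.
apply: (bilin_pre (b := @tens k W (W ⊗ W)%type) (f := id) (g := br a)).
- exact: tens_bilinear.
- exact: id_linear.
- exact: brP.2.
Qed.

Lemma ractL_bilinear a :
  bilinear_for *:%R *:%R (fun u v : W => perm23 (br u a ⊗ v)).
Proof.
apply: (bilin_post (b := fun u v => br u a ⊗ v)); last exact: perm23_linear.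
apply: (bilin_pre (b := @tens k (W ⊗ W)%type W) (f := br^~ a) (g := id)).
- exact: tens_bilinear.
- exact: brP.1.
- exact: id_linear.
Qed.

Lemma actL_linear a : linear (actL br a).
Proof. exact/tlift_linear/actL_bilinear. Qed.

Lemma actR_linear a : linear (actR br a).
Proof. exact/tlift_linear/actR_bilinear. Qed.

Lemma ractL_linear a : linear ((ractL br)^~ a).
Proof. exact/tlift_linear/ractL_bilinear. Qed.

Lemma actLE a u v : actL br a (u ⊗ v) = br a u ⊗ v.
Proof. exact: tlift_tens (actL_bilinear a) u v. Qed.

Lemma actRE a u v : actR br a (u ⊗ v) = tassoc (u ⊗ br a v).
Proof. exact: tlift_tens (actR_bilinear a) u v. Qed.

Lemma ractLE a u v : ractL br (u ⊗ v) a = perm23 (br u a ⊗ v).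
Proof. exact: tlift_tens (ractL_bilinear a) u v. Qed.

End StructuralMaps.

Lemma ga_map_comp (k : comNzRingType) (G H K : zmodType) (s : G -> H) (r : H -> K)
  (f : grpalg k G) : ga_map r (ga_map s f) = ga_map (r \o s) f.
Proof.
move: f; apply: ga_ext => [||a]; last by rewrite !ga_mapU.
  exact/(lin_comp (ga_map_linear s))/ga_map_linear.
exact: ga_map_linear.
Qed.

(** * The Jacobi identity in three variables *)

Section ThreeVariables.
Variable k : fieldType.

Local Notation V := (laurent k).
Local Notation quot := (@bracket0_quot k).
Local Notation exp3 := (int * int * int)%type.

Definition laurent3 : comAlgType k := grpalg k exp3.

Definition exp_x (a : int) : exp3 := (a, 0, 0).
Definition exp_y (a : int) : exp3 := (0, a, 0).
Definition exp_z (a : int) : exp3 := (0, 0, a).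
Definition exp_xy (p : int * int) : exp3 := (p.1, p.2, 0).
Definition exp_xz (p : int * int) : exp3 := (p.1, 0, p.2).
Definition exp_yz (p : int * int) : exp3 := (0, p.1, p.2).
Definition exp_zy (p : int * int) : exp3 := (0, p.2, p.1).

Definition sub_exp (s : int * int -> exp3) : laurent2 k -> laurent3 := ga_map s.
Definition sub_x : V -> laurent3 := ga_map exp_x.
Definition sub_y : V -> laurent3 := ga_map exp_y.
Definition sub_z : V -> laurent3 := ga_map exp_z.
Definition mono3 a b c : laurent3 := monom k (a, b, c).

Lemma quot_sub (s : int * int -> exp3) (f g : V) : {morph s : p q / p + q} ->
  (monom k (s (0, 1)) - monom k (s (1, 0)) : laurent3) * sub_exp s (quot f g)
  = sub_exp s (in_x f) * sub_exp s (in_y g)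
    - sub_exp s (in_x g) * sub_exp s (in_y f).
Proof.
move=> sM; have := congr1 (ga_map s) (bracket0_quotE f g).
by rewrite (ga_mapM sM) !(linB (ga_map_linear _)) !(ga_mapM sM) !ga_mapU.
Qed.

Definition tens2_laurent : V ⊗ V -> laurent2 k :=
  tlift (fun f g => in_x f * in_y g).
Definition tens3_laurent : V ⊗ V ⊗ V -> laurent3 :=
  tlift (fun w f => sub_exp exp_xy (tens2_laurent w) * sub_z f).
Definition laurent3_tens : laurent3 -> V ⊗ V ⊗ V :=
  ga_lin (fun m => tpow k m.1.1 ⊗ tpow k m.1.2 ⊗ tpow k m.2).

Lemma tens2_bilinear : bilinear_for *:%R *:%R (fun f g : V => in_x f * in_y g).
Proof. by apply: mul_bilinear; [exact: in_x_linear | exact: in_y_linear]. Qed.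

Lemma tens2_linear : linear tens2_laurent.
Proof. exact/tlift_linear/tens2_bilinear. Qed.

Lemma tens2_laurentK : cancel (@laurent2_tens k) tens2_laurent.
Proof.
apply: ga_ext => [||[a b]].
- exact/(lin_comp (@laurent2_tens_linear k))/tens2_linear.
- exact: id_linear.
rewrite -[monom k _]/(xypow k a b) laurent2_tensU.
rewrite /tens2_laurent (tlift_tens tens2_bilinear) /in_x /in_y !laurent_linE.
by rewrite -xypowD addr0 add0r.
Qed.

Lemma tens3_bilinear : bilinear_for *:%R *:%R
  (fun (w : V ⊗ V) (f : V) => sub_exp exp_xy (tens2_laurent w) * sub_z f).
Proof.
apply: mul_bilinear; last exact: ga_map_linear.
exact/(lin_comp tens2_linear)/ga_map_linear.
Qed.

Lemma tens3_linear : linear tens3_laurent.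
Proof. exact/tlift_linear/tens3_bilinear. Qed.

Lemma tens3E (q : laurent2 k) (f : V) :
  tens3_laurent (laurent2_tens q ⊗ f) = sub_exp exp_xy q * sub_z f.
Proof. by rewrite /tens3_laurent (tlift_tens tens3_bilinear) tens2_laurentK. Qed.

Lemma tens3U a b c :
  tens3_laurent (tpow k a ⊗ tpow k b ⊗ tpow k c) = mono3 a b c.
Proof.
rewrite -laurent2_tensU tens3E /sub_exp /sub_z !ga_mapU monomM.
by rewrite -[_ + _]/(a + 0, b + 0, 0 + c) !addr0 add0r.
Qed.

Lemma laurent3_tens_linear : linear laurent3_tens.
Proof. exact: ga_lin_linear. Qed.

(** Gives injectivity of [tens3_laurent], so that identities of tensors can be checked on Laurent
    polynomials. *)
Lemma tens3K : cancel tens3_laurent laurent3_tens.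
Proof.
have SL := laurent3_tens_linear.
have STL := lin_comp tens3_linear SL.
apply: tens_ext => [||w h]; [exact: STL | exact: id_linear | ].
move: w; apply: tens_ext => [||f g].
- exact: (lin_comp (tens_linearl h) STL).
- exact: tens_linearl.
move: f; apply: ga_ext => [||a].
- exact: (lin_comp (tens_linearl g) (lin_comp (tens_linearl h) STL)).
- exact: (lin_comp (tens_linearl g) (tens_linearl h)).
move: g; apply: ga_ext => [||b].
- exact: (lin_comp (tens_linearr (monom k a)) (lin_comp (tens_linearl h) STL)).
- exact: (lin_comp (tens_linearr (monom k a)) (tens_linearl h)).
move: h; apply: ga_ext => [||c].
- exact: (lin_comp (tens_linearr (monom k a ⊗ monom k b)) STL).
- exact: tens_linearr.
by rewrite tens3U /laurent3_tens /mono3 ga_lin_monom.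
Qed.

Lemma tens3_tassoc (q : laurent2 k) (f : V) :
  tens3_laurent (tassoc (f ⊗ laurent2_tens q)) = sub_x f * sub_exp exp_yz q.
Proof.
have TL := lin_comp (@tassoc_linear k V) tens3_linear.
move: q; apply: ga_ext => [||[b c]].
- exact: (lin_comp (@laurent2_tens_linear k) (lin_comp (tens_linearr f) TL)).
- exact/lin_mull/ga_map_linear.
rewrite -[monom k _]/(xypow k b c) laurent2_tensU.
move: f; apply: ga_ext => [||a].
- exact: (lin_comp (tens_linearl _) TL).
- exact/lin_mulr/ga_map_linear.
rewrite tassocE -[monom k a]/(tpow k a) tens3U /sub_x /sub_exp !ga_mapU monomM.
by rewrite -[_ + _]/(a + 0, 0 + b, 0 + c) addr0 !add0r.
Qed.

Lemma tens3_perm23 (q : laurent2 k) (f : V) :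
  tens3_laurent (perm23 (laurent2_tens q ⊗ f)) = sub_exp exp_xz q * sub_y f.
Proof.
have TL := lin_comp (@perm23_linear k V) tens3_linear.
move: q; apply: ga_ext => [||[a c]].
- exact: (lin_comp (@laurent2_tens_linear k) (lin_comp (tens_linearl f) TL)).
- exact/lin_mulr/ga_map_linear.
rewrite -[monom k _]/(xypow k a c) laurent2_tensU.
move: f; apply: ga_ext => [||b].
- exact: (lin_comp (tens_linearr _) TL).
- exact/lin_mull/ga_map_linear.
rewrite perm23E -[monom k b]/(tpow k b) tens3U /sub_y /sub_exp !ga_mapU monomM.
by rewrite -[_ + _]/(a + 0, 0 + b, c + 0) !addr0 !add0r.
Qed.

Local Notation X := (mono3 1 0 0).
Local Notation Y := (mono3 0 1 0).
Local Notation Z := (mono3 0 0 1).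
Local Notation br := (@bracket0 k).

Lemma sub_exp_in_x s (f : V) : sub_exp s (in_x f) = ga_map (fun a => s (a, 0)) f.
Proof. exact: (ga_map_comp (fun a => (a, 0)) s). Qed.

Lemma sub_exp_in_y s (f : V) : sub_exp s (in_y f) = ga_map (fun a => s (0, a)) f.
Proof. exact: (ga_map_comp (fun a => (0, a)) s). Qed.

Lemma quot_xy f g :
  (Y - X) * sub_exp exp_xy (quot f g) = sub_x f * sub_y g - sub_x g * sub_y f.
Proof.
by have := @quot_sub exp_xy f g; rewrite !sub_exp_in_x !sub_exp_in_y; exact.
Qed.

Lemma quot_yz f g :
  (Z - Y) * sub_exp exp_yz (quot f g) = sub_y f * sub_z g - sub_y g * sub_z f.
Proof.
by have := @quot_sub exp_yz f g; rewrite !sub_exp_in_x !sub_exp_in_y; exact.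
Qed.

Lemma quot_xz f g :
  (Z - X) * sub_exp exp_xz (quot f g) = sub_x f * sub_z g - sub_x g * sub_z f.
Proof.
by have := @quot_sub exp_xz f g; rewrite !sub_exp_in_x !sub_exp_in_y; exact.
Qed.

Lemma quot_zy f g :
  (Y - Z) * sub_exp exp_zy (quot f g) = sub_z f * sub_y g - sub_z g * sub_y f.
Proof.
by have := @quot_sub exp_zy f g; rewrite !sub_exp_in_x !sub_exp_in_y; exact.
Qed.


Lemma sub_xyU a b :
  sub_exp exp_xy (xypow k a b) = sub_x (tpow k a) * sub_y (tpow k b).
Proof.
rewrite /sub_exp /sub_x /sub_y !ga_mapU monomM.
by rewrite -[_ + _]/(a + 0, 0 + b, 0 + 0) !addr0 add0r.
Qed.

Lemma sub_xzU a b :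
  sub_exp exp_xz (xypow k a b) = sub_x (tpow k a) * sub_z (tpow k b).
Proof.
rewrite /sub_exp /sub_x /sub_z !ga_mapU monomM.
by rewrite -[_ + _]/(a + 0, 0 + 0, 0 + b) !addr0 add0r.
Qed.

Lemma sub_yzU a b :
  sub_exp exp_yz (xypow k a b) = sub_y (tpow k a) * sub_z (tpow k b).
Proof.
rewrite /sub_exp /sub_y /sub_z !ga_mapU monomM.
by rewrite -[_ + _]/(0 + 0, a + 0, 0 + b) !addr0 !add0r.
Qed.

Lemma sub_zyU a b :
  sub_exp exp_zy (xypow k a b) = sub_z (tpow k a) * sub_y (tpow k b).
Proof.
rewrite /sub_exp /sub_y /sub_z !ga_mapU monomM.
by rewrite -[_ + _]/(0 + 0, 0 + b, a + 0) !addr0 !add0r.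
Qed.

(** For a monomial q = u(x) v(y) the action is the quotient of [a] and u in x, y, times v(z).
    Clearing y - x leaves products that reassemble into q(y,z) and q(x,z), and linearity extends
    this to every [q]. *)
Lemma tens3_actL (a : V) (q : laurent2 k) :
  (Y - X) * tens3_laurent (actL br a (laurent2_tens q))
  = sub_x a * sub_exp exp_yz q - sub_y a * sub_exp exp_xz q.
Proof.
have aL := actL_linear (@bracket0_bilinear k) a.
move: q; apply: ga_ext => [||[u v]].
- apply: lin_mull.
  exact: (lin_comp (@laurent2_tens_linear k) (lin_comp aL tens3_linear)).
- by apply: lin_sub; apply: lin_mull; exact: ga_map_linear.
rewrite -[monom k _]/(xypow k u v) laurent2_tensU.
rewrite (actLE (@bracket0_bilinear k)) tens3E mulrA quot_xy sub_yzU sub_xzU.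
move: (sub_x a) (sub_y a) (sub_x _) (sub_y _) (sub_z _) => *; ring.
Qed.

Lemma tens3_actR (b : V) (q : laurent2 k) :
  (Z - Y) * tens3_laurent (actR br b (laurent2_tens q))
  = sub_y b * sub_exp exp_xz q - sub_exp exp_xy q * sub_z b.
Proof.
have aL := actR_linear (@bracket0_bilinear k) b.
move: q; apply: ga_ext => [||[u v]].
- apply: lin_mull.
  exact: (lin_comp (@laurent2_tens_linear k) (lin_comp aL tens3_linear)).
- by apply: lin_sub; [apply: lin_mull | apply: lin_mulr]; exact: ga_map_linear.
rewrite -[monom k _]/(xypow k u v) laurent2_tensU.
rewrite (actRE (@bracket0_bilinear k)) tens3_tassoc mulrCA quot_yz.
rewrite sub_xyU sub_xzU.
move: (sub_y b) (sub_z b) (sub_x _) (sub_y _) (sub_z _) => *; ring.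
Qed.

(** For q = u(x) v(y) the bracket of u with [c] occupies x and z while v sits in y; the second
    summand of its numerator has u in z, which gives q(z,y) and explains [exp_zy]. *)
Lemma tens3_ractL (c : V) (q : laurent2 k) :
  (Z - X) * tens3_laurent (ractL br (laurent2_tens q) c)
  = sub_exp exp_xy q * sub_z c - sub_x c * sub_exp exp_zy q.
Proof.
have aL := ractL_linear (@bracket0_bilinear k) c.
move: q; apply: ga_ext => [||[u v]].
- apply: lin_mull.
  exact: (lin_comp (@laurent2_tens_linear k) (lin_comp aL tens3_linear)).
- by apply: lin_sub; [apply: lin_mulr | apply: lin_mull]; exact: ga_map_linear.
rewrite -[monom k _]/(xypow k u v) laurent2_tensU.
rewrite (ractLE (@bracket0_bilinear k)) tens3_perm23 mulrA quot_xz.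
rewrite sub_xyU sub_zyU.
move: (sub_x c) (sub_z c) (sub_x _) (sub_y _) (sub_z _) => *; ring.
Qed.

Lemma yx3_lreg : GRing.lreg (Y - X).
Proof.
apply: monomB_lreg => n /(congr1 (fun p : exp3 => p.1.2)) /=.
by rewrite !raddfMn /= subr0 => /eqP; rewrite mulrn_eq0 orbF => /eqP.
Qed.

Lemma zy3_lreg : GRing.lreg (Z - Y).
Proof.
apply: monomB_lreg => n /(congr1 snd) /=.
by rewrite !raddfMn /= subr0 => /eqP; rewrite mulrn_eq0 orbF => /eqP.
Qed.

Lemma zx3_lreg : GRing.lreg (Z - X).
Proof.
apply: monomB_lreg => n /(congr1 snd) /=.
by rewrite !raddfMn /= subr0 => /eqP; rewrite mulrn_eq0 orbF => /eqP.
Qed.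

(* Here a1, a2, a3 stand for a(x), a(y), a(z), and similarly for b and c;      *)
(* p, q and s are {{b,c}}, {{a,c}} and {{a,b}} in the indicated variables, and *)
(* t1, t2, t3 are the three terms of the Jacobi identity.                      *)
Lemma jacobi_cleared (A : comNzRingType) (x y z a1 a2 a3 b1 b2 b3 c1 c2 c3
    p23 p13 q13 q12 s12 s32 t1 t2 t3 : A) :
  (y - x) * t1 = a1 * p23 - a2 * p13 ->
  (z - y) * t2 = b2 * q13 - q12 * b3 ->
  (z - x) * t3 = s12 * c3 - c1 * s32 ->
  (z - y) * p23 = b2 * c3 - c2 * b3 ->
  (z - x) * p13 = b1 * c3 - c1 * b3 ->
  (z - x) * q13 = a1 * c3 - c1 * a3 ->
  (y - x) * q12 = a1 * c2 - c1 * a2 ->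
  (y - x) * s12 = a1 * b2 - b1 * a2 ->
  (y - z) * s32 = a3 * b2 - b3 * a2 ->
  (y - x) * ((z - y) * ((z - x) * (t1 - t2 - t3))) = 0.
Proof.
move=> h1 h2 h3 h4 h5 h6 h7 h8 h9.
(* Each unknown is regrouped with the difference that clears it; after two rounds only values at x,
   y, z remain. *)
have -> : (y - x) * ((z - y) * ((z - x) * (t1 - t2 - t3))) =
    (z - y) * (z - x) * ((y - x) * t1) - (y - x) * (z - x) * ((z - y) * t2)
    - (y - x) * (z - y) * ((z - x) * t3) by ring.
rewrite h1 h2 h3.
have -> : (z - y) * (z - x) * (a1 * p23 - a2 * p13) -
    (y - x) * (z - x) * (b2 * q13 - q12 * b3) -
    (y - x) * (z - y) * (s12 * c3 - c1 * s32) =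
  (z - x) * a1 * ((z - y) * p23) - (z - y) * a2 * ((z - x) * p13)
  - (y - x) * b2 * ((z - x) * q13) + (z - x) * b3 * ((y - x) * q12)
  - (z - y) * c3 * ((y - x) * s12) - (y - x) * c1 * ((y - z) * s32) by ring.
rewrite h4 h5 h6 h7 h8 h9; ring.
Qed.

Lemma bracket0_jacobi (a b c : V) :
  actL br a (br b c) - actR br b (br a c) - ractL br (br a b) c = 0.
Proof.
rewrite -[LHS]tens3K.
suff -> : tens3_laurent (actL br a (br b c) - actR br b (br a c)
    - ractL br (br a b) c) = 0
  by rewrite (lin0 laurent3_tens_linear).
rewrite !(linB tens3_linear); apply/zx3_lreg/zy3_lreg/yx3_lreg.
rewrite !mulr0.
exact: (jacobi_cleared (tens3_actL a _) (tens3_actR b _) (tens3_ractL c _)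
  (quot_yz b c) (quot_xz b c) (quot_xz a c) (quot_xy a c) (quot_xy a b)
  (quot_zy a b)).
Qed.

Lemma bracket0_double_Lie : double_Lie br 0.
Proof.
split=> [|a b|a b c]; first exact: bracket0_bilinear.
  by rewrite scale0r bracket0_antisym.
by rewrite oppr0 scale0r bracket0_jacobi.
Qed.

End ThreeVariables.

(** * Supports, and contraction of the bracket by a functional *)

Lemma ga_bounded_support (k : comNzRingType) (f : grpalg k int) :
  exists N : nat, forall b, N%:Z <= `|b| -> ga_coef f b = 0.
Proof.
elim/monom_ind: f => [|c f g [N Nf] [M Mg]|a].
- by exists 0%N => b _; rewrite ga_coef0.
- exists (maxn N M) => b le; rewrite ga_coefD ga_coefZ Nf ?Mg ?mulr0 ?addr0 //.
    by apply: le_trans le; rewrite lez_nat leq_maxr.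
  by apply: le_trans le; rewrite lez_nat leq_maxl.
exists `|a|.+1 => b; rewrite ga_coefU.
by case: eqP => // <-; rewrite -abszE lez_nat ltnn.
Qed.

(** Abstracts the slices of t^N: [c m b] stands for the coefficient of t^b in the slice at [m], and
    [u m] for phi(t^m). Each step down from [m = N] moves the support down by one and can add only
    the exponent [N - 1]. *)
Lemma backward_recurrence_supp (R : pzRingType) (N : int) (c : int -> int -> R)
    (u : int -> R) :
  (forall b, c N b = 0) ->
  (forall m b, c m b = c (m + 1) (b + 1) - u m * (N == b + 1)%:R) ->
  forall (i : nat) b, ~~ (N - i%:Z <= b < N) -> c (N - i%:Z) b = 0.
Proof.
move=> c0 cS; elim=> [|i IH] b Hb; first by rewrite subr0.
rewrite cS (_ : N - i.+1%:Z + 1 = N - i%:Z); last by lia.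
rewrite IH; last by lia.
by rewrite (_ : (N == b + 1) = false) ?mulr0 ?subr0 //; lia.
Qed.

Section Contraction.
Variables (k : fieldType) (phi : laurent k -> k^o).
Hypothesis phiL : linear phi.

Local Notation V := (laurent k).
Local Notation br := (@bracket0 k).
Local Notation quot := (@bracket0_quot k).
Local Notation t := (tpow k).

Definition contract : V ⊗ V -> V := tlift (fun u v => phi v *: u).

Lemma contract_bilinear : bilinear_for *:%R *:%R (fun u v : V => phi v *: u).
Proof.
split=> [v|u] a w w' /=; first by rewrite scalerDr !scalerA mulrC.
by rewrite phiL scalerDl -scalerA.
Qed.

Lemma contract_linear : linear contract.
Proof. exact/tlift_linear/contract_bilinear. Qed.

Lemma contractE u v : contract (u ⊗ v) = phi v *: u.
Proof. exact: tlift_tens contract_bilinear u v. Qed.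

(** [phi] kills the summand in V ⊗ I, and the summand in I ⊗ V contracts to a combination of
    elements of [I]. *)
Lemma contract_ideal (I : {pred V}) w : submod_closed I ->
  {in I, phi =1 fun=> 0} -> tens_ideal I w -> contract w \in I.
Proof.
move=> [I0 IP] phiI [_ [_ [[s1 s1P ->] [s2 s2P ->] ->]]].
rewrite (linD contract_linear) !(lin_sum contract_linear).
rewrite [X in _ + X]big1_seq ?addr0; last first.
  move=> p /andP[_ /s2P /andP[_ pI]].
  by rewrite contractE phiI // scale0r.
rewrite big_seq; elim/big_ind: _ => //.
  by move=> u v uI vI; rewrite -[u]scale1r; apply: IP.
by move=> p /s1P /andP[pI _]; rewrite contractE -[_ *: _]addr0; apply: IP.
Qed.

(* The element h_m(f) of the introductory comment. *)
Definition slice (f : V) (m : int) : V := contract (br f (t m)).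

Lemma slice_linear m : linear (slice^~ m).
Proof. exact: (lin_comp (@bracket0_linearl k (t m)) contract_linear). Qed.

(** The contraction only touches the second factor, that is, the variable y. *)
Lemma contract_varx q :
  contract (laurent2_tens (varx k * q)) = t 1 * contract (laurent2_tens q).
Proof.
have CL := lin_comp (@laurent2_tens_linear k) contract_linear.
move: q; apply: ga_ext => [||[a b]].
- exact: (lin_comp (lin_mull _ (@id_linear _ _)) CL).
- exact: (lin_mull _ CL).
have -> : varx k * monom k (a, b) = xypow k (1 + a) b.
  by rewrite [LHS](monomM k (1, 0)) -[_ + _]/(1 + a, 0 + b) add0r.
rewrite -[monom k _]/(xypow k a b).
rewrite (laurent2_tensU k (1 + a)) (laurent2_tensU k a).
transitivity (phi (t b) *: t (1 + a)); first exact: contractE.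
transitivity (t 1 * (phi (t b) *: t a)); first by rewrite -scalerAr monomM.
by congr (_ * _); symmetry; exact: contractE.
Qed.

Lemma laurent2_tens_mul (f g : V) : laurent2_tens (in_x f * in_y g) = f ⊗ g.
Proof.
move: f; apply: ga_ext => [||a].
- exact: (lin_comp (lin_mulr _ (@in_x_linear k)) (@laurent2_tens_linear k)).
- exact: tens_linearl.
move: g; apply: ga_ext => [||b].
- exact: (lin_comp (lin_mull _ (@in_y_linear k)) (@laurent2_tens_linear k)).
- exact: tens_linearr.
by rewrite /in_x /in_y !laurent_linE -xypowD addr0 add0r laurent2_tensU.
Qed.

(** The numerator for t^(m+1) is x times the one for t^m, plus (y - x) f(x) y^m. *)
Lemma quot_shift (f : V) m :
  quot f (t (m + 1)) = varx k * quot f (t m) + in_x f * in_y (t m).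
Proof.
apply: quotP.
have -> : in_x (t (m + 1)) = varx k * in_x (t m).
  by rewrite /in_x !laurent_linE -xypowD addr0 addrC.
have -> : in_y (t (m + 1)) = vary k * in_y (t m).
  by rewrite /in_y !laurent_linE -xypowD addr0 addrC.
rewrite mulrDr mulrCA.
move: (bracket0_quotE f (t m)); move: (_ * quot f (t m)) => q ->.
move: (in_x f) (in_y f) (in_x _) (in_y _) (varx k) (vary k) => *; ring.
Qed.

Lemma slice_shift f m : slice f (m + 1) = t 1 * slice f m + phi (t m) *: f.
Proof.
rewrite /slice /bracket0 quot_shift (linD (@laurent2_tens_linear k)).
rewrite (linD contract_linear) laurent2_tens_mul.
by congr (_ + _); [exact: contract_varx | exact: contractE].
Qed.

Lemma slice_diag m : slice (t m) m = 0.
Proof.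
rewrite /slice /bracket0 (_ : quot _ _ = 0).
  by rewrite (lin0 (@laurent2_tens_linear k)) (lin0 contract_linear).
by apply: quotP; rewrite mulr0 subrr.
Qed.

Lemma slice_coef f m b : ga_coef (slice f m) b
  = ga_coef (slice f (m + 1)) (b + 1) - phi (t m) * ga_coef f (b + 1).
Proof.
have e := congr1 (fun g : V => ga_coef g (b + 1)) (slice_shift f m).
apply: canRL (addrK _) _; apply: etrans (esym e) => {e}.
move: (slice f m) => g; rewrite ga_coefD ga_coefZ ga_coef_monomM.
by rewrite [b + 1 - 1]addrK.
Qed.

Lemma slice_monom_coef (n : int) (i : nat) b : ~~ (n <= b < n + i%:Z) ->
  ga_coef (slice (t (n + i%:Z)) n) b = 0.
Proof.
pose c m d : k := ga_coef (slice (t (n + i%:Z)) m) d.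
have c0 d : c (n + i%:Z) d = 0 by rewrite /c slice_diag ga_coef0.
have cS m d : c m d = c (m + 1) (d + 1) - phi (t m) * (n + i%:Z == d + 1)%:R.
  by rewrite -ga_coefU; exact: slice_coef.
have := backward_recurrence_supp c0 cS (i := i) (b := b).
by rewrite addrK; exact.
Qed.

(** The top term is created by the last step of the recurrence, from [n + 1] to [n]: the slice at
    [n + 1] has no term at [n + i + 1] that could shift onto it. *)
Lemma slice_monom_top (n : int) (i : nat) :
  ga_coef (slice (t (n + i.+1%:Z)) n) (n + i%:Z) = - phi (t n).
Proof.
pose c m d : k := ga_coef (slice (t (n + i.+1%:Z)) m) d.
have c0 d : c (n + i.+1%:Z) d = 0 by rewrite /c slice_diag ga_coef0.
have cS m d : c m d = c (m + 1) (d + 1) - phi (t m) * (n + i.+1%:Z == d + 1)%:R.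
  by rewrite -ga_coefU; exact: slice_coef.
have nE : n + i.+1%:Z - i%:Z = n + 1 by lia.
have iE : n + i%:Z + 1 = n + i.+1%:Z by lia.
have := backward_recurrence_supp c0 cS (i := i) (b := n + i.+1%:Z).
rewrite nE ltxx andbF => /(_ isT) cT.
by rewrite -[LHS]/(c n (n + i%:Z)) cS iE cT eqxx mulr1 sub0r.
Qed.

Definition supp_in (n : int) (d : nat) (f : V) :=
  forall b, ~~ (n <= b < n + d%:Z) -> ga_coef f b = 0.

Lemma slice_supp n d f : supp_in n d.+1 f -> supp_in n d (slice f n).
Proof.
move=> fS b Hb; rewrite (monomE f) (lin_sum (slice_linear n)).
rewrite (big_morph (fun h : V => ga_coef h b)
  (fun g h => ga_coefD g h b) (ga_coef0 _ b)).
rewrite big1_seq // => a _; rewrite (linZ (slice_linear n)) ga_coefZ.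
have [aI|aI] := boolP (n <= a < n + d.+1%:Z); last by rewrite fS ?mul0r.
have aE : a = n + `|a - n|%N%:Z by lia.
by rewrite {2}aE slice_monom_coef ?mulr0 //; lia.
Qed.

Lemma slice_top n d f : supp_in n d.+2 f ->
  ga_coef (slice f n) (n + d%:Z) = - phi (t n) * ga_coef f (n + d.+1%:Z).
Proof.
move=> fS; pose c := ga_coef f (n + d.+1%:Z).
(* Without its top monomial [f] is shorter, so its slice has no term at [n + d]; the top monomial
   alone contributes there. *)
have gS : supp_in n d.+1 (- c *: t (n + d.+1%:Z) + f).
  move=> b Hb; rewrite ga_coefD ga_coefZ ga_coefU.
  case: eqP => [<-|ne]; first by rewrite mulr1 addNr.
  by rewrite mulr0 add0r fS //; lia.
have := slice_supp gS; move/(_ (n + d%:Z)); rewrite slice_linear => h.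
have {h} : ga_coef (- c *: slice (t (n + d.+1%:Z)) n + slice f n) (n + d%:Z) = 0.
  by apply: h; lia.
have := slice_monom_top n d.
move: (slice (t (n + d.+1%:Z)) n) (slice f n) => p q.
rewrite ga_coefD ga_coefZ => -> /eqP; rewrite addrC addr_eq0 => /eqP ->.
by rewrite mulrNN mulrC mulNr.
Qed.

End Contraction.

(** * Elements of least width in an ideal, and simplicity *)

Section Simplicity.
Variables (k : fieldType) (I : {pred laurent k}) (phi : laurent k -> k^o).

Local Notation V := (laurent k).
Local Notation br := (@bracket0 k).
Local Notation t := (tpow k).

Hypothesis phiL : linear phi.
Hypothesis phiI : {in I, phi =1 fun=> 0}.
Hypothesis Iideal : ideal br I.

Lemma ideal_lin a f g : f \in I -> g \in I -> a *: f + g \in I.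
Proof. by case: Iideal => -[_ IP] _; apply: IP. Qed.

Lemma ideal_scale_inv a f : a != 0 -> a *: f \in I -> f \in I.
Proof.
move=> a0 afI; have [[I0 _] _] := Iideal.
by have := ideal_lin a^-1 afI I0; rewrite addr0 scalerA mulVf // scale1r.
Qed.

Lemma slice_ideal f m : f \in I -> slice phi f m \in I.
Proof.
have [Isub IP] := Iideal => fI; apply: (contract_ideal phiL Isub phiI).
by case: (IP (t m) f fI).
Qed.

Lemma supp_in0 n (f : V) : supp_in n 0 f -> f = 0.
Proof. by move=> fS; apply: ga_coefP => b; rewrite ga_coef0 fS //; lia. Qed.

Lemma supp_in_last n d (f : V) :
  supp_in n d.+1 f -> ga_coef f (n + d%:Z) = 0 -> supp_in n d f.
Proof.
move=> fS f0 b Hb; have [->//|ne] := eqVneq b (n + d%:Z).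
by rewrite fS //; lia.
Qed.

Lemma supp_in_shift m n d (f : V) :
  supp_in n d f -> supp_in (n + m) d (t m * f).
Proof. by move=> fS b Hb; rewrite ga_coef_monomM fS //; lia. Qed.

Lemma tpowK m (f : V) : t (- m) * (t m * f) = f.
Proof. by rewrite mulrA monomM addNr mul1r. Qed.

Lemma tpow_neq0 m (f : V) : f != 0 -> t m * f != 0.
Proof. by apply: contraNneq => e; rewrite -(tpowK m f) e mulr0. Qed.

Section MinimalWidth.
Variable d : nat.
Hypothesis dmin : forall n f, f \in I -> supp_in n d f -> f = 0.

Definition minimal n f := [/\ f \in I, f != 0 & supp_in n d.+1 f].

Lemma minimal_slice n f : minimal n f -> slice phi f n = 0.
Proof.
by case=> fI f0 fS; apply: (dmin (n := n) (slice_ideal n fI)); exact: slice_supp.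
Qed.

Lemma minimal_phi n f : minimal n f -> phi (t n) = 0.
Proof.
move=> fmin; have [fI f0 fS] := fmin.
have lf : ga_coef f (n + d%:Z) != 0.
  by apply: contra f0 => /eqP /(supp_in_last fS) /(dmin fI) ->.
have s0 := minimal_slice fmin.
(* In width one the slice has no top coefficient to compare, but [f] is then a multiple of t^n and
   [phi f = 0] applies directly. *)
have [d0|d_gt0] := posnP d.
  have fE : f = ga_coef f n *: t n.
    apply: ga_coefP => b; rewrite ga_coefZ ga_coefU.
    case: eqP => [<-|ne]; first by rewrite mulr1.
    by rewrite mulr0 fS //; lia.
  move: lf; rewrite d0 addr0 => lf.
  have := phiI fI; rewrite fE (linZ phiL) => /eqP.
  by rewrite mulf_eq0 (negPf lf) => /eqP.
move: fS lf; rewrite -(prednK d_gt0) => fS lf.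
have := slice_top phiL fS; rewrite s0 ga_coef0 => /esym/eqP.
by rewrite mulf_eq0 (negPf lf) orbF oppr_eq0 => /eqP.
Qed.

Lemma minimal_shift m n f :
  minimal n f -> t m * f \in I -> minimal (n + m) (t m * f).
Proof.
by case=> fI f0 fS tfI; split=> //; [exact: tpow_neq0 | exact: supp_in_shift].
Qed.

(* If phi(t^(n+j)) is the first nonzero value from n on, then the slices at    *)
(* n+j+1 and n+j+2 are phi(t^(n+j)) f and phi(t^(n+j)) t f + phi(t^(n+j+1)) f, *)
(* so t f is again in I.                                                       *)
Lemma minimal_phi_up (j : nat) n f : minimal n f -> phi (t (n + j%:Z)) = 0.
Proof.
elim/ltn_ind: j n f => j IH n f fmin; have [fI f0 fS] := fmin.
have [pj0|pj] := eqVneq (phi (t (n + j%:Z))) 0; first exact: pj0.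
have s0 (i : nat) : (i <= j)%N -> slice phi f (n + i%:Z) = 0.
  elim: i => [_|i IHi le_ij]; first by rewrite addr0; exact: minimal_slice.
  rewrite (_ : n + i.+1%:Z = n + i%:Z + 1); last by lia.
  rewrite slice_shift // IHi 1?ltnW // mulr0 add0r.
  by rewrite (IH i le_ij n f fmin) scale0r.
have s1 : slice phi f (n + j%:Z + 1) = phi (t (n + j%:Z)) *: f.
  by rewrite slice_shift // s0 // mulr0 add0r.
have tfI : t 1 * f \in I.
  apply: (ideal_scale_inv pj).
  have := slice_ideal (n + j%:Z + 1 + 1) fI.
  rewrite slice_shift // s1.
  move: (phi _) (phi _) => p q sI.
  have := ideal_lin (- p) fI sI.
  by rewrite addrCA scaleNr addNr addr0 -scalerAr.
(* As t f is minimal with start [n + 1], the same exponent is now one step closer and the induction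
   hypothesis applies. *)
case: j IH pj {s0 s1} => [|j] IH pj.
  by move: pj; rewrite addr0 (minimal_phi fmin) eqxx.
have := IH j (ltnSn j) _ _ (minimal_shift fmin tfI).
by rewrite (_ : n + 1 + j%:Z = n + j.+1%:Z) //; lia.
Qed.

(** The recurrence is run backwards from the vanishing slice at [n]. Solving it for the lower slice
    divides by t, so the first nonzero phi(t^m) below [n] already yields a multiple of f / t in the
    ideal, and a single slice suffices. Then f / t is minimal and closer to that exponent. *)
Lemma minimal_phi_down (j : nat) n f : minimal n f -> phi (t (n - j%:Z)) = 0.
Proof.
elim/ltn_ind: j n f => j IH n f fmin; have [fI f0 fS] := fmin.
have [pj0|pj] := eqVneq (phi (t (n - j%:Z))) 0; first exact: pj0.
case: j IH pj => [|j] IH pj; first by rewrite subr0 (minimal_phi fmin).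
have back m : slice phi f (m + 1) = 0 -> 
    slice phi f m = - phi (t m) *: (t (- 1) * f).
  rewrite slice_shift // => /eqP; rewrite addr_eq0 => /eqP e.
  by rewrite -[LHS](tpowK 1) e mulrN -scalerAr scaleNr.
have s0 (i : nat) : (i <= j)%N -> slice phi f (n - i%:Z) = 0.
  elim: i => [_|i IHi le_ij]; first by rewrite subr0; exact: minimal_slice.
  rewrite back; first by rewrite (IH i.+1 _ n f fmin) ?ltnS // oppr0 scale0r.
  by rewrite (_ : n - i.+1%:Z + 1 = n - i%:Z); [apply/IHi/ltnW | lia].
have tfI : t (- 1) * f \in I.
  apply: (@ideal_scale_inv (- phi (t (n - j.+1%:Z)))); first by rewrite oppr_eq0.
  rewrite -back; first exact: slice_ideal.
  by rewrite (_ : n - j.+1%:Z + 1 = n - j%:Z); [apply/s0 | lia].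
have := IH j (ltnSn j) _ _ (minimal_shift fmin tfI).
by rewrite (_ : n - 1 - j%:Z = n - j.+1%:Z) //; lia.
Qed.

Lemma minimal_phi0 n f : minimal n f -> phi =1 fun=> 0.
Proof.
move=> fmin; apply: ga_ext => // [a u v|m]; first by rewrite scaler0 addr0.
have [le|gt] := lerP n m.
  by have := minimal_phi_up `|m - n|%N fmin; rewrite (_ : n + _ = m) //; lia.
by have := minimal_phi_down `|n - m|%N fmin; rewrite (_ : n - _ = m) //; lia.
Qed.

End MinimalWidth.

Lemma ideal_phi0 f : f \in I -> f != 0 -> phi =1 fun=> 0.
Proof.
move=> fI f0.
pose P d := `[< exists n g, [/\ g \in I, g != 0 & supp_in n d g] >].
have exP : exists d, P d.
  have [N fN] := ga_bounded_support f.
  (* Coefficients vanish once the absolute value of the exponent reaches [N], so the interval from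
     [-N] up to but excluding [N] contains the support. *)
  exists (N + N)%N; apply/asboolP; exists (- N%:Z), f; split=> // b Hb.
  by apply: fN; lia.
have [[|d] /asboolP[n [g [gI g0 gS]]] dmin] := ex_minnP exP.
  by move: g0; rewrite (supp_in0 gS) eqxx.
apply: (@minimal_phi0 d _ n g) => // m h hI hS; apply/eqP/negPn/negP => h0.
have /dmin : P d by apply/asboolP; exists m, h.
by rewrite ltnn.
Qed.

End Simplicity.

Lemma bracket0_simple (k : fieldType) : simple_double_Lie (@bracket0 k).
Proof.
split.
  (* The numerator for 1 and t is y - x itself, so the quotient is 1. *)
  exists (tpow k 0), (tpow k 1).
  apply/eqP => /(congr1 (@tens2_laurent k)).
  rewrite tens2_laurentK (lin0 (@tens2_linear k)).
  suff -> : bracket0_quot (tpow k 0) (tpow k 1) = 1 by apply/eqP/oner_neq0.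
  apply: quotP; rewrite mulr1 /in_x /in_y !laurent_linE.
  by rewrite -!xypowD !addr0 !add0r.
move=> I Iid; have [Isub _] := Iid.
have [[f [fI f0]]|I0] := pselect (exists f, f \in I /\ f != 0); last first.
  left=> f; rewrite inE; have [->|f0] := eqVneq f 0; first by case: Isub.
  by apply/negbTE/negP => fI; apply: I0; exists f.
right=> v; rewrite [RHS]inE; apply/negPn/negP => vI.
have [phi [phiL phiv phiI]] := submod_functional Isub vI.
have := ideal_phi0 phiL phiI Iid fI f0 v.
by rewrite phiv; apply/eqP/oner_neq0.
Qed.

Theorem theorem4p3 (k : fieldType) :
  double_Lie (@bracket0 k) 0 /\ simple_double_Lie (@bracket0 k).
Proof. by split; [exact: bracket0_double_Lie | exact: bracket0_simple]. Qed.
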